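(* Let $G$ be a finite group acting linearly on a finite-dimensional complex vector space $V$. Let $I\subseteq\mathbb{R}$ be an open interval and $c:I\to V/\!\!/G=\sigma(V)\subseteq\mathbb{C}^n$ a curve of class $C^D$. Then there exists a global differentiable curve $\bar c:I\to V$ with $\sigma\circ\bar c=c$ if and only if $c$ is $1$-flat at every $t\in I$.
   Context: For a finite group $H$ acting linearly on a complex vector space $W$, choose a minimal system of homogeneous generators of $\mathbb{C}[W]^H$ and let $d(W,H)$ be the maximum of their degrees. Here $\sigma=(\sigma_1,\dots,\sigma_n)$ for a minimal system of homogeneous generators $\sigma_1,\dots,\sigma_n$ of $\mathbb{C}[V]^G$, and $V/\!\!/G$ is identified with $\sigma(V)$. Let $D$ be the maximum of $d(V,G_v)$ over all $v\in V$, where $G_v$ is the isotropy group of $v$ (for finite $G$ the slice representation at $v$ is $G_v$ acting on $V$). 1-flatness: let $t\in I$ and $v\in\sigma^{-1}(c(t))$. Let $\tau_1,\dots,\tau_m$ be a minimal system of homogeneous generators of $\mathbb{C}[V]^{G_v}$ with degrees $d'_1,\dots,d'_m$, and $\tau=(\tau_1,\dots,\tau_m):V\to\mathbb{C}^m$. By Luna's slice theorem there is a $G_v$-invariant open neighborhood $S$ of $0$ in $V$ such that $\tau(x)\mapsto\sigma(v+x)$ ($x\in S$) is a well-defined homeomorphism $\Phi$ from $\tau(S)$ onto an open neighborhood of $c(t)$ in $\sigma(V)$, with $\Phi(0)=c(t)$. The curve $c$ is $1$-flat at $t$ if, for $s$ near $t$, $\Phi^{-1}(c(s))=\big((s-t)^{d'_1}a_1(s),\dots,(s-t)^{d'_m}a_m(s)\big)$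 for some continuous functions $a_1,\dots,a_m$ defined near $t$. *)

(* Defs.v *)
From HB Require Import structures.
From mathcomp Require Import all_boot all_order all_algebra all_fingroup.
From mathcomp Require Import mxrepresentation.
From mathcomp Require Import complex.
From mathcomp Require Import all_classical all_reals topology normedtype derive.
From mathcomp Require mpoly.
Import (canonicals, coercions) mpoly.
Set Implicit Arguments.
Unset Strict Implicit.
Unset Printing Implicit Defensive.
Import Order.TTheory GRing.Theory Num.Theory numFieldNormedType.Exports.
Local Open Scope ring_scope.

(* The complex numbers are R[i] for a real field R : realType;
   V = C^N is modelled as row vectors 'rV[R[i]]_N, a group element g acting
   linearly by x |-> x *m rho g (rho a matrix representation of G). *)

Definition cabs {R : realType} (z : R[i]) : R :=
  Num.sqrt (complex.Re z ^+ 2 + complex.Im z ^+ 2).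

Definition vclose {R : realType} {k : nat} (e : R) (x y : 'rV[R[i]]_k) :=
  forall i, cabs (x 0 i - y 0 i) < e.

Definition vopen {R : realType} {k : nat} (S : set 'rV[R[i]]_k) :=
  forall x, S x -> exists2 e : R, 0 < e & forall y, vclose e y x -> S y.

Notation cpoly R N := (mpoly.mpoly N R[i]).

Definition pdeg {R : realType} {N : nat} (p : cpoly R N) : nat :=
  (mpoly.msize p).-1.

Definition is_homogeneous {R : realType} {N : nat} (p : cpoly R N) :=
  exists d, p \is mpoly.ishomog1 d (@mpoly.mdeg N).

(* p o A, i.e. the polynomial x |-> p (x *m A) *)
Definition poly_act {R : realType} {N : nat} (A : 'M[R[i]]_N) (p : cpoly R N)
  : cpoly R N :=
  mpoly.comp_mpoly
    [tuple \sum_(i < N) A i j *: mpoly.mpolyX R[i] (mpoly.mnm1 i) | j < N] p.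

Definition invariant {R : realType} {gT : finGroupType} {G : {group gT}}
  {N : nat} (rho : mx_representation R[i] G N) (H : {set gT}) (p : cpoly R N) :=
  forall g, g \in H -> poly_act (rho g) p = p.

Definition subst {R : realType} {N m : nat} (s : 'I_m -> cpoly R N)
  (q : cpoly R m) : cpoly R N :=
  mpoly.comp_mpoly [tuple s j | j < m] q.

(* s_1, ..., s_m is a minimal system of homogeneous generators of C[V]^H :
   homogeneous invariants generating the invariant algebra, none of which
   lies in the subalgebra generated by the others. *)
Definition min_hom_gen {R : realType} {gT : finGroupType} {G : {group gT}}
  {N : nat} (rho : mx_representation R[i] G N) (H : {set gT})
  (m : nat) (s : 'I_m -> cpoly R N) :=
  [/\ forall j, is_homogeneous (s j),
      forall j, invariant rho H (s j),
      forall p, invariant rho H p -> exists q, p = subst s q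
    & forall j, ~ exists q,
        s j = subst (fun k => if k == j then 0 else s k) q].

Definition isotropy {R : realType} {gT : finGroupType} {G : {group gT}}
  {N : nat} (rho : mx_representation R[i] G N) (v : 'rV[R[i]]_N) : {set gT} :=
  [set g in G | v *m rho g == v].

Definition polymap {R : realType} {N m : nat} (s : 'I_m -> cpoly R N)
  (x : 'rV[R[i]]_N) : 'rV[R[i]]_m :=
  \row_(j < m) mpoly.meval (fun k => x 0 k) (s j).

(* d(V, H) = d : some minimal system of homogeneous generators of C[V]^H has
   maximal degree d (this degree does not depend on the choice). *)
Definition dVH {R : realType} {gT : finGroupType} {G : {group gT}}
  {N : nat} (rho : mx_representation R[i] G N) (H : {set gT}) (d : nat) :=
  exists m (s : 'I_m -> cpoly R N),
    min_hom_gen rho H s /\ (\max_(j < m) pdeg (s j))%N = d.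

Definition is_D {R : realType} {gT : finGroupType} {G : {group gT}}
  {N : nat} (rho : mx_representation R[i] G N) (D : nat) :=
  (exists v, dVH rho (isotropy rho v) D) /\
  (forall v d, dVH rho (isotropy rho v) d -> (d <= D)%N).

Definition oitv {R : realType} (a b : \bar R) : set R :=
  fun t => (a < t%:E)%E /\ (t%:E < b)%E.

Definition Ck_on {R : realType} (I : set R) (k : nat) (f : R -> R) :=
  (forall j, (j < k)%N -> forall t, I t -> derivable (derive1n j f) t 1) /\
  (forall t, I t -> {for t, continuous (derive1n k f)}).

Definition curve_Ck {R : realType} {n : nat} (I : set R) (k : nat)
  (c : R -> 'rV[R[i]]_n) :=
  forall i, Ck_on I k (fun t => complex.Re (c t 0 i)) /\
            Ck_on I k (fun t => complex.Im (c t 0 i)).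

Definition curve_diff {R : realType} {N : nat} (I : set R)
  (c : R -> 'rV[R[i]]_N) :=
  forall i t, I t -> derivable (fun s => complex.Re (c s 0 i)) t 1 /\
                    derivable (fun s => complex.Im (c s 0 i)) t 1.

(* Luna slice data at v: S is a G_v-invariant open neighbourhood of 0 such that
   Phi : tau(x) |-> sigma(v + x) (x in S) is a well-defined homeomorphism
   from tau(S) onto an open neighbourhood of sigma(v) in sigma(V). *)
Definition luna_slice {R : realType} {gT : finGroupType} {G : {group gT}}
  {N n m : nat} (rho : mx_representation R[i] G N) (sigma : 'I_n -> cpoly R N)
  (v : 'rV[R[i]]_N) (tau : 'I_m -> cpoly R N) (S : set 'rV[R[i]]_N) :=
  [/\ vopen S, S 0,
      (forall g, g \in isotropy rho v -> forall x, S x -> S (x *m rho g)),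
      (* well defined and injective *)
      (forall x y, S x -> S y ->
         (polymap tau x = polymap tau y <-> polymap sigma (v + x) = polymap sigma (v + y)))
    & [/\
      (exists O : set 'rV[R[i]]_n, vopen O /\
         forall z, (exists2 x, S x & polymap sigma (v + x) = z) <->
                   (O z /\ exists w, polymap sigma w = z)),
      (forall x, S x -> forall e : R, 0 < e -> exists2 d : R, 0 < d &
         forall y, S y -> vclose d (polymap tau y) (polymap tau x) ->
           vclose e (polymap sigma (v + y)) (polymap sigma (v + x)))
    &
      (forall x, S x -> forall e : R, 0 < e -> exists2 d : R, 0 < d &
         forall y, S y -> vclose d (polymap sigma (v + y)) (polymap sigma (v + x)) ->
           vclose e (polymap tau y) (polymap tau x))]].

Definition one_flat_at {R : realType} {gT : finGroupType} {G : {group gT}}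
  {N n : nat} (rho : mx_representation R[i] G N) (sigma : 'I_n -> cpoly R N)
  (I : set R) (c : R -> 'rV[R[i]]_n) (t : R) :=
  forall v, polymap sigma v = c t ->
  forall m (tau : 'I_m -> cpoly R N), min_hom_gen rho (isotropy rho v) tau ->
  exists S, luna_slice rho sigma v tau S /\
  exists2 d : R, 0 < d &
  exists a : 'I_m -> R -> R[i],
    (forall j s, I s -> `|s - t| < d ->
        {for s, continuous (fun u => complex.Re (a j u))} /\
        {for s, continuous (fun u => complex.Im (a j u))}) /\
    (forall s, I s -> `|s - t| < d ->
       exists2 x, S x &
         polymap sigma (v + x) = c s /\
         polymap tau x = \row_(j < m) ((complex.Complex (s - t) 0) ^+ pdeg (tau j) * a j s)).

(* Main.v *)
(** A set-theoretic lift [f] of a curve that is 1-flat everywhere is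
    "differentiable modulo [G]": near [t] some translate of [f s] equals
    [f t + (s - t) w + o(s - t)]. Indeed homogeneity turns the normal form
    [(s - t)^d_j a_j(s)] into [tau (x(s) / (s - t)) = a(s)], and [tau] induces a
    homeomorphism from the orbit space onto its closed image. Such an [f] is
    turned into a differentiable lift by induction on the order of the group.
    Away from the parameters where [f] is fixed by the group the isotropy is
    smaller; at an accumulation point of these parameters value and derivative
    are both fixed, so every lift is differentiable there; at an isolated one
    the two one-sided derivatives of a lift lie in one orbit and can be matched
    by a group element. Conversely, the difference quotient [x(s) / (s - t)] of a
    differentiable lift is continuous, and [a = tau o (x / (s - t))]. The minimal
    systems of generators that 1-flatness quantifies over exist by Noether's
    finiteness theorem. *)

Require Import Defs.
From HB Require Import structures.
From mathcomp Require Import all_boot all_order all_algebra all_fingroup.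
From mathcomp Require Import mxrepresentation.
From mathcomp Require Import complex.
From mathcomp Require Import all_classical all_reals topology normedtype derive.
From mathcomp Require Import lra.
From mathcomp Require mpoly.
Import (canonicals, coercions) mpoly.
Set Implicit Arguments.
Unset Strict Implicit.
Unset Printing Implicit Defensive.
Import Order.TTheory GRing.Theory Num.Theory numFieldNormedType.Exports.
Local Open Scope classical_set_scope.
Local Open Scope ring_scope.

(** * Real functions and intervals *)

Lemma continuous_interval_lt (R : realType) (J : set R) (m : R -> R) (c : R) :
  is_interval J -> (forall s, J s -> {for s, continuous m}) ->
  (forall s, J s -> m s != c) ->
  forall s t, J s -> J t -> m s < c -> m t < c.
Proof.
move=> /connected_intervalP Jconn m_cont m_neq s t Js Jt ms.
have mJ : is_interval (m @` J).
  apply/connected_intervalP/connected_continuous_connected => //.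
  by apply: continuous_in_subspaceT => u /set_mem /m_cont.
rewrite ltNge; apply/negP => mt.
have [u Ju mu] : (m @` J) c.
  by apply: (mJ (m s) (m t)); [exists s | exists t | rewrite (ltW ms)].
by move: (m_neq u Ju); rewrite mu eqxx.
Qed.

Lemma is_interval_ball (R : realType) (t d : R) : is_interval (ball t d).
Proof. by rewrite ball_itv; apply: interval_is_interval. Qed.

Lemma is_intervalI (R : realType) (I J : set R) :
  is_interval I -> is_interval J -> is_interval (I `&` J).
Proof. by move=> Iint Jint x y [Ix Jx] [Iy Jy] z xyz; split; [apply: Iint xyz|apply: Jint xyz]. Qed.

Lemma is_intervalU (R : realType) (I J : set R) :
  I `&` J !=set0 -> is_interval I -> is_interval J -> is_interval (I `|` J).
Proof.
move=> IJ /connected_intervalP Iconn /connected_intervalP Jconn.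
exact/connected_intervalP/connectedU.
Qed.

Lemma interval_closure_between (R : realType) (J : set R) (x y t : R) :
  is_interval J -> closure J x -> closure J y -> x < t < y -> J t.
Proof.
move=> Jint clx cly /andP[xt ty].
have [x' [Jx' /= x't]] := clx _ (lt_nbhsl xt).
have [y' [Jy' /= ty']] := cly _ (lt_nbhsr ty).
by apply: (Jint x' y') => //; rewrite !ltW.
Qed.

Lemma closure_interval_near (R : realType) (J : set R) (b : R) :
  is_interval J -> ~ J b -> \forall t \near b, closure J t -> J t \/ t = b.
Proof.
move=> Jint nJb; have [clJb|nclJb] := pselect (closure J b); last first.
  have /open_nbhs_nbhs : open_nbhs b (~` closure J).
    by split=> //; apply/closed_openC/closed_closure.
  by apply: filterS => t nclJt /nclJt.
have [s [Js _]] := clJb _ filterT; have clJs := subset_closure Js.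
have sb : s != b by apply/eqP => sb; rewrite sb in Js.
have dist_gt0 : 0 < `|s - b| by rewrite normr_gt0 subr_eq0.
near=> t; have : `|b - t| < `|s - b| by near: t; apply: nbhsx_ballx.
move=> tb clJt; have [->|tNb] := eqVneq t b; [by right|left].
have : [|| s < t < b, b < t < s, s < b < t | t < b < s].
  by move: sb tNb tb; rewrite !neq_lt ltr_norml; case: (ltrP s b); lra.
have between := interval_closure_between Jint.
case/or4P => [stb|bts|/between sbt|/between tbs]; last by case: nJb; apply: tbs.
- exact: between stb.
- exact: between bts.
- by case: nJb; apply: sbt.
Unshelve. all: by end_near. Qed.

Lemma open_connected_component (R : realType) (U : set R) (t : R) :
  open U -> open (connected_component U t).
Proof.
move=> U_open; rewrite openE => s Cs.
have [e e0 eU] : exists2 e : R, 0 < e & ball s e `<=` U.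
  apply/nbhs_ballP; apply: open_nbhs_nbhs; split=> //.
  exact: connected_component_sub Cs.
rewrite (same_connected_component Cs) /interior.
apply: filterS (nbhsx_ballx s e e0); apply: connected_component_max => //.
  exact: ballxx.
exact/connected_intervalP/is_interval_ball.
Qed.

Lemma interval_missing_limit_point (R : realType) (I J : set R) :
  is_interval I -> open J -> J `<=` I -> J !=set0 -> J <> I ->
  exists2 b, I b & ~ J b /\ closure J b.
Proof.
move=> /connected_intervalP Iconn J_open JI J0 J_neq; apply: contrapT => no_b.
apply: J_neq; apply: Iconn => //; first by exists J => //; rewrite setIidr.
exists (closure J); first exact: closed_closure.
apply/seteqP; split=> b; first by move=> Jb; split; [exact: JI|exact: subset_closure].
by move=> [Ib clb]; apply: contrapT => nJb; apply: no_b; exists b.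
Qed.

Lemma dnbhs_near_dnbhs (R : realType) (t : R) (P : set R) :
  (\forall s \near t^', P s) -> \forall s \near t, \forall u \near s^', P u.
Proof.
rewrite near_withinE => /near_join; apply: filterS => s; rewrite near_withinE.
have [->//|st] := eqVneq s t.
have u_neq : \forall u \near s, u != t.
  by apply: open_nbhs_nbhs; split; [exact: open_neq|].
by apply: filterS2 u_neq => u ut /(_ ut).
Qed.

(** * Lifting curves that are differentiable modulo a finite group *)

Lemma near_scale_le (R : realType) (V : normedModType R) (t : R) (w : V) (e : R) :
  0 < e -> \forall s \near t, `|(s - t) *: w| <= e.
Proof.
move=> e0; have C0 : 0 < 1 + `|w| by rewrite ltr_pwDl.
have d0 : 0 < e / (1 + `|w|) by rewrite divr_gt0.
apply: filterS (nbhsx_ballx t _ d0) => s; rewrite /ball /= distrC ltr_pdivlMr //.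
by rewrite normrZ mulrDr mulr1 => /ltW; apply: le_trans; rewrite lerDr.
Qed.

Section Jets.

Variables (R : realType) (V : normedModType R).
Implicit Types (A B : set R) (F : R -> V) (s t : R) (v w : V).

Definition has_jet A F t v w := forall e : R, 0 < e ->
  \forall s \near t, A s -> `|F s - v - (s - t) *: w| <= e * `|s - t|.

Lemma near_remainder_norm_le t w (e r : R) : 0 < r -> \forall s \near t, forall x : V,
  `|x - (s - t) *: w| <= e * `|s - t| -> `|x| <= r.
Proof.
move=> r0; have r20 : 0 < r / 2 by rewrite divr_gt0.
apply: filterS2 (near_scale_le t w r20) (near_scale_le t (e : R^o) r20) => s sw se x Hx.
have := ler_normD (x - (s - t) *: w) ((s - t) *: w); rewrite subrK.
by move: se; rewrite normrZ mulrC => se; have := ler_norm e; have := normr_ge0 (s - t); nra.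
Qed.

Lemma derivable_has_jet F t : derivable F t 1 <-> exists w, has_jet setT F t (F t) w.
Proof.
have quotientE (h : R) w : h != 0 ->
    `|F (t + h) - F t - (t + h - t) *: w|
      = `|w - h^-1 *: ((F \o shift t) (h *: 1) - F t)| * `|h|.
  move=> h0; rewrite [t + h]addrC addrK mulrC -normrZ scalerBr scalerA divff //.
  by rewrite scale1r /= [h *: 1]mulr1 -[RHS]normrN opprB.
split=> [/cvg_ex[w /cvgrPdist_le Fw]|[w Fw]].
  exists w => e /Fw; rewrite near_withinE => Hw; apply/nbhs0P.
  apply: filterS Hw => h Hh _; have [->|h0] := eqVneq h 0.
    by rewrite addr0 !subrr scale0r subrr !normr0 mulr0.
  by rewrite quotientE // [t + h]addrC addrK ler_wpM2r // Hh.
apply/cvg_ex; exists w; apply/cvgrPdist_le => e /Fw /nbhs0P.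
rewrite near_withinE; apply: filterS => h /(_ I) Hh /= h0.
by move: Hh; rewrite quotientE // [t + h]addrC addrK ler_pM2r // normr_gt0.
Qed.

Lemma has_jetS A B F t v w : A `<=` B -> has_jet B F t v w -> has_jet A F t v w.
Proof. by move=> AB Fv e /Fv; apply: filterS => s HB /AB. Qed.

Lemma has_jetU A B F t v w :
  has_jet A F t v w -> has_jet B F t v w -> has_jet (A `|` B) F t v w.
Proof. by move=> FA FB e e0; apply: filterS2 (FA e e0) (FB e e0) => s ? ? []. Qed.

Lemma eq_has_jet A F G t v w : (forall s, A s -> F s = G s) ->
  has_jet A F t v w -> has_jet A G t v w.
Proof. by move=> FG Fv e /Fv; apply: filterS => s Hs As; rewrite -FG ?Hs. Qed.

End Jets.

Lemma total_on_directed (T : Type) (C : set (set T)) (A B : set T) :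
  total_on C subset -> C A -> C B -> exists2 E, C E & A `<=` E /\ B `<=` E.
Proof.
move=> chain CA CB; have [AB|BA] := chain A B CA CB; first by exists B => //; split.
by exists A => //; split.
Qed.

Section Lifting.

Variables (R : realType) (V : normedModType R) (gT : finGroupType).
Variable act : gT -> {linear V -> V}.
Hypothesis act1 : forall x, act 1%g x = x.
Hypothesis actM : forall g h x, act h (act g x) = act (g * h)%g x.
Hypothesis norm_act : forall g x, `|act g x| = `|x|.

Implicit Types (H K : {group gT}) (I J : set R) (f F L : R -> V).
Implicit Types (g h : gT) (s t : R) (v w x : V) (e : R).

Definition diff_mod H f t w := forall e : R, 0 < e ->
  \forall s \near t, exists2 g, g \in H &
    `|act g (f s) - f t - (s - t) *: w| <= e * `|s - t|.

Definition lift_at H f F s := exists2 g, g \in H & F s = act g (f s).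

Definition diff_lift_at H f F s := lift_at H f F s /\ derivable F s 1.

Lemma actK g x : act g^-1%g (act g x) = x.
Proof. by rewrite actM mulgV act1. Qed.

Lemma act_line g v (r : R) w : act g (v + r *: w) = act g v + r *: act g w.
Proof. by rewrite linearD linearZ. Qed.

Lemma lift_at_refl H f s : lift_at H f f s.
Proof. by exists 1%g; rewrite ?act1. Qed.

Lemma lift_at_sym H f F s : lift_at H f F s -> lift_at H F f s.
Proof. by move=> [g Hg Fs]; exists g^-1%g; rewrite ?groupV // Fs actK. Qed.

Lemma lift_at_trans H f F L s : lift_at H f F s -> lift_at H F L s -> lift_at H f L s.
Proof.
move=> [g Hg Fs] [h Hh Ls]; exists (g * h)%g; first exact: groupM.
by rewrite Ls Fs actM.
Qed.

Lemma lift_at_act H f F s h : h \in H -> lift_at H f F s -> lift_at H f (act h \o F) s.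
Proof. by move=> Hh /lift_at_trans; apply; exists h. Qed.

Lemma near_eq_diff_lift_at H f F L t : (\forall s \near t, F s = L s) ->
  diff_lift_at H f F t -> diff_lift_at H f L t.
Proof.
move=> FL [[g Hg Ft] dF]; split; last exact: near_eq_derivable dF.
by exists g => //; rewrite -(nbhs_singleton FL).
Qed.

Lemma has_jet_act A F t v w h :
  has_jet A F t v w -> has_jet A (act h \o F) t (act h v) (act h w).
Proof.
move=> Fv e /Fv; apply: filterS => s Hs /Hs.
by rewrite /= -linearZ -!linearB norm_act.
Qed.

Lemma derivable_act F t h : derivable F t 1 -> derivable (act h \o F) t 1.
Proof.
move=> /derivable_has_jet[w Fw]; apply/derivable_has_jet; exists (act h w).
exact: has_jet_act.
Qed.

Lemma diff_lift_at_act H f F s h : h \in H ->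
  diff_lift_at H f F s -> diff_lift_at H f (act h \o F) s.
Proof. by move=> Hh [/(lift_at_act Hh) Fl Fd]; split=> //; apply: derivable_act. Qed.

Lemma has_jet_diff_mod H F t w : has_jet setT F t (F t) w -> diff_mod H F t w.
Proof.
by move=> Fw e /Fw; apply: filterS => s Hs; exists 1%g; rewrite ?act1 ?Hs.
Qed.

Lemma lift_near_line H f t w F e : diff_mod H f t w -> 0 < e ->
  \forall s \near t, lift_at H f F s -> exists2 h, h \in H &
    `|F s - act h (f t + (s - t) *: w)| <= e * `|s - t|.
Proof.
move=> fw /fw; apply: filterS => s [g Hg Hs] [k Hk Fs].
exists (g^-1 * k)%g; first by rewrite groupM ?groupV.
by rewrite -[f s](actK g) actM in Fs; rewrite Fs -linearB norm_act opprD addrA.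
Qed.

Lemma diff_mod_norm_le H f t w e : diff_mod H f t w -> 0 < e ->
  \forall s \near t, exists2 g, g \in H & `|act g (f s) - f t| <= e.
Proof.
move=> fw e0; apply: filterS2 (fw 1 ltr01) (near_remainder_norm_le t w 1 e0).
by move=> s [g Hg gs] /(_ _ gs); exists g.
Qed.

Lemma diff_mod_lift H f F t w : diff_mod H f t w ->
  (\forall s \near t, lift_at H f F s) -> exists w', diff_mod H F t w'.
Proof.
move=> fw fF; have [k Hk Ft] := nbhs_singleton fF; exists (act k w) => e e0.
apply: filterS2 fF (lift_near_line F fw e0) => s Fs /(_ Fs) [h Hh Hs].
exists (h^-1 * k)%g; first by rewrite groupM ?groupV.
rewrite Ft -actM -linearZ -!linearB norm_act -(norm_act h) !linearB /=.
by move: Hs; rewrite linearD opprD addrA !actM mulVg act1.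
Qed.

Lemma line_gap t x w : (x, w) != 0 ->
  \forall eta \near 0^'+, \forall s \near t, eta * `|s - t| <= `|x + (s - t) *: w|.
Proof.
have [->|x0 _] := eqVneq x 0; rewrite ?eqxx //.
  rewrite xpair_eqE eqxx /= => w0; near=> eta; near=> s; rewrite add0r normrZ mulrC.
  by rewrite ler_wpM2l //; near: eta; apply: nbhs_right_le; rewrite normr_gt0.
have x20 : 0 < `|x| / 2 by rewrite divr_gt0 ?normr_gt0.
near=> eta; have eta1 : eta <= 1 by near: eta; apply: nbhs_right_le.
near=> s; have : `|(s - t) *: w| <= `|x| / 2 by near: s; apply: near_scale_le.
have : `|t - s| < `|x| / 2 by near: s; apply: nbhsx_ballx.
have := lerB_normD x ((s - t) *: w); have := normr_ge0 (s - t).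
rewrite [`|t - s|]distrC; nra.
Unshelve. all: by end_near. Qed.

Lemma orbit_line_gap v w t : exists2 eta : R, 0 < eta & \forall s \near t, forall g h,
  `|act g (v + (s - t) *: w) - act h (v + (s - t) *: w)| < eta * `|s - t| ->
  act g v = act h v /\ act g w = act h w.
Proof.
have gap (gh : gT * gT) : \forall eta \near 0^'+, \forall s \near t,
    `|act gh.1 (v + (s - t) *: w) - act gh.2 (v + (s - t) *: w)| < eta * `|s - t| ->
    act gh.1 v = act gh.2 v /\ act gh.1 w = act gh.2 w.
  set x := act gh.1 v - act gh.2 v; set y := act gh.1 w - act gh.2 w.
  have lineE s : act gh.1 (v + (s - t) *: w) - act gh.2 (v + (s - t) *: w)
      = x + (s - t) *: y.
    by rewrite !act_line opprD addrACA -scalerBr.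
  have [|/line_gap gap_xy] := eqVneq (x, y) 0.
    move=> /pair_equal_spec[/eqP + /eqP]; rewrite !subr_eq0 => /eqP xv /eqP yw.
    by near=> eta; near=> s.
  near=> eta; near=> s; rewrite lineE ltNge => /negP[]; near: s; near: eta.
  exact: gap_xy.
have [eta [eta0 Heta]] := filter_ex (filterI (nbhs_right_gt 0) (filter_forall _ gap)).
exists eta => //; apply: filterS (filter_forall _ Heta) => s Hs g h.
exact: (Hs (g, h)).
Unshelve. all: by end_near. Qed.

(* The ratio [|F s - h0 (v + (s - b) w)| / |s - b|] never takes the value
   [eta / 2], so by the intermediate value theorem it stays below it. *)
Lemma follows_one_line H J F b v w (eta : R) : is_interval J -> J !=set0 -> ~ J b ->
  0 < eta -> (forall s, J s -> {for s, continuous F}) ->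
  (forall s, J s -> exists2 h, h \in H &
     `|F s - act h (v + (s - b) *: w)| <= eta / 4 * `|s - b|) ->
  (forall s, J s -> forall g h,
     `|act g (v + (s - b) *: w) - act h (v + (s - b) *: w)| < eta * `|s - b| ->
     act g v = act h v /\ act g w = act h w) ->
  exists2 h, h \in H & forall s, J s ->
    `|F s - act h (v + (s - b) *: w)| < eta / 2 * `|s - b|.
Proof.
move=> Jint [s0 Js0] nJb eta0 F_cont close gap.
have dist_gt0 s : J s -> 0 < `|s - b|.
  by move=> Js; rewrite normr_gt0 subr_eq0; apply/eqP => sb; rewrite sb in Js.
have [h0 Hh0 close0] := close s0 Js0; exists h0 => // s Js.
pose m s := `|F s - act h0 (v + (s - b) *: w)| / `|s - b|.
rewrite -ltr_pdivrMr ?dist_gt0 // -/(m s).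
apply: (continuous_interval_lt Jint _ _ Js0 Js) => [{Js}s Js|{Js}s Js|].
- apply: cvgM; last first.
    apply: cvgV; first by rewrite gt_eqF ?dist_gt0.
    by apply: cvg_norm; apply: cvgB; [exact: cvg_id|exact: cvg_cst].
  apply: cvg_norm; apply: cvgB; first exact: F_cont.
  under eq_fun do rewrite act_line; rewrite act_line.
  apply: cvgD; first exact: cvg_cst.
  by apply: cvgZr_tmp; apply: cvgB; [exact: cvg_id|exact: cvg_cst].
- have s_gt0 := dist_gt0 s Js; have [h Hh Fh] := close s Js.
  apply/eqP => /(canRL (divfK (lt0r_neq0 s_gt0))) Fh0.
  have [|hv hw] := gap s Js h h0.
    have := ler_distD (F s) (act h (v + (s - b) *: w)) (act h0 (v + (s - b) *: w)).
    by rewrite [`|act h _ - F s|]distrC Fh0; nra.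
  by move: Fh; rewrite act_line hv hw -act_line Fh0; nra.
- by rewrite /m ltr_pdivrMr ?dist_gt0 //; have := dist_gt0 s0 Js0; nra.
Qed.

Lemma lift_one_sided_jet H J f F b w : is_interval J -> ~ J b -> diff_mod H f b w ->
  (\forall s \near b, J s -> lift_at H f F s /\ {for s, continuous F}) ->
  exists2 h, h \in H & has_jet J F b (act h (f b)) (act h w).
Proof.
move=> Jint nJb fw JF; have [eta eta0 gap] := orbit_line_gap (f b) w b.
have near_line e : 0 < e -> \forall s \near b, J s -> exists2 h, h \in H &
    `|F s - act h (f b + (s - b) *: w)| <= e * `|s - b|.
  by move=> e0; apply: filterS2 JF (lift_near_line F fw e0) => s JF Hs /JF[/Hs].
have eta40 : 0 < eta / 4 by rewrite divr_gt0.
have [d /= d0 Hd] := (nbhs_ballP _ _).1 (filterI (filterI gap JF) (near_line _ eta40)).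
pose J0 := J `&` ball b d.
have [J0_ex|J0_empty] := pselect (J0 !=set0); last first.
  exists 1%g => // e e0; apply: filterS (nbhsx_ballx b d d0) => s bs Js.
  by case: J0_empty; exists s.
have [|||||h Hh Fh] := @follows_one_line H J0 F b (f b) w eta _ J0_ex _ eta0.
- exact: is_intervalI Jint (@is_interval_ball _ b d).
- by case=> /nJb.
- by move=> s [Js /Hd[[_ /(_ Js)[]]]].
- by move=> s [Js /Hd[_]]; apply.
- by move=> s [_ /Hd[[]]].
exists h => // e e0; near=> s => Js.
have sd : ball b d s by near: s; apply: nbhsx_ballx.
have s_gt0 : 0 < `|s - b|.
  by rewrite normr_gt0 subr_eq0; apply/eqP => sb; rewrite sb in Js.
have [k Hk Fk] : exists2 k, k \in H &
    `|F s - act k (f b + (s - b) *: w)| <= Num.min e (eta / 4) * `|s - b|.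
  by move: Js; near: s; apply: near_line; rewrite lt_min e0.
move: Fk; rewrite minr_pMl // le_min => /andP[Fke Fk].
have [|kv kw] := (Hd s sd).1.1 k h.
  have := ler_distD (F s) (act k (f b + (s - b) *: w)) (act h (f b + (s - b) *: w)).
  rewrite [`|act k _ - F s|]distrC; have := Fh s (conj Js sd); nra.
by move: Fke; rewrite act_line kv kw opprD addrA.
Unshelve. all: by end_near. Qed.

Lemma derivable_two_sided_jets F t w :
  has_jet [set s | s < t] F t (F t) w -> has_jet [set s | t < s] F t (F t) w ->
  derivable F t 1.
Proof.
move=> Fl Fr; apply/derivable_has_jet; exists w => e e0.
apply: filterS2 (Fl e e0) (Fr e e0) => s Hl Hr _.
have [st|ts|->] := ltgtP s t; [exact: Hl|exact: Hr|].
by rewrite !subrr scale0r subrr !normr0 mulr0.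
Qed.

Definition locally_diff_liftable H f t := exists L, \forall s \near t, diff_lift_at H f L s.

Lemma diff_lift_glue H f F L J b w : open J -> ~ J b ->
  (forall s, J s -> diff_lift_at H f F s) -> has_jet J F b (L b) w ->
  lift_at H f L b -> has_jet setT L b (L b) w ->
  exists F', [/\ forall s, J s -> F' s = F s, forall s, J s -> diff_lift_at H f F' s,
    diff_lift_at H f F' b
    & forall s, ~ closure J s -> diff_lift_at H f L s -> diff_lift_at H f F' s].
Proof.
move=> Jopen nJb F_lift Fjet Lb Ljet.
pose F' s := if pselect (J s) then F s else L s.
have F'J s : J s -> F' s = F s by rewrite /F'; case: pselect.
have F'L s : ~ J s -> F' s = L s by rewrite /F'; case: pselect.
exists F'; split=> // [s Js||s clJs Ls].
- apply: near_eq_diff_lift_at (F_lift s Js).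
  by apply: filterS (open_nbhs_nbhs (conj Jopen Js)) => u /F'J.
- split; first by rewrite /lift_at F'L.
  apply/derivable_has_jet; exists w; rewrite F'L // -(setUv J); apply: has_jetU.
    by apply: eq_has_jet Fjet => s /F'J.
  by apply: eq_has_jet (has_jetS (@subsetT _ _) Ljet) => s /F'L.
have : (~` J)^° s by rewrite interiorC.
by move=> nJ_near; apply: near_eq_diff_lift_at Ls; apply: filterS nJ_near => u /F'L.
Qed.

(* A local lift [L] at an endpoint [b] of [J] can be moved by an element of [H]
   so as to match the one-sided first order expansion of [F] at [b]. *)
Lemma diff_lift_extend H f F J b (U : set R) : is_interval J -> open J -> ~ J b ->
  (J !=set0 -> closure J b) -> (forall s, J s -> diff_lift_at H f F s) ->
  (\forall s \near b, U s) -> locally_diff_liftable H f b ->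
  exists J' F', [/\ is_interval J', open J', J' `<=` J `|` U, J `<=` J' /\ J' b
    & (forall s, J s -> F' s = F s) /\ (forall s, J' s -> diff_lift_at H f F' s)].
Proof.
move=> Jint Jopen nJb clJb F_lift bU [L L_lift].
have [Llb /derivable_has_jet[w Lw]] := nbhs_singleton L_lift.
have [|h Hh Fjet] := lift_one_sided_jet Jint nJb (has_jet_diff_mod H Lw) (F := F).
  apply: filterS L_lift => s [Ls _] /F_lift[Fs dF]; split.
    exact: lift_at_trans (lift_at_sym Ls) Fs.
  exact/differentiable_continuous/derivable1_diffP.
have [F' [F'F F'J F'b F'L]] := diff_lift_glue (L := act h \o L) Jopen nJb F_lift Fjet
  (lift_at_act Hh Llb) (has_jet_act h Lw).
have [e /= e0 He] := (nbhs_ballP _ _).1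
  (filterI (filterI bU L_lift) (closure_interval_near Jint nJb)).
exists (J `|` ball b e), F'; split.
- have [J_ex|/nonemptyPn J_empty] := pselect (J !=set0); last first.
    by rewrite J_empty set0U; apply: is_interval_ball.
  have [s [Js bs]] := clJb J_ex _ (nbhsx_ballx b e e0).
  by apply: is_intervalU => //; [exists s | apply: is_interval_ball].
- exact: openU (ball_open _ _).
- by move=> s [Js|/He[[Us _] _]]; [left|right].
- by split; [move=> s; left|right; apply: ballxx].
split=> // s J's; have [->|sNb] := eqVneq s b; first exact: F'b.
have [/F'J//|nJs] := pselect (J s).
have [[_ Ls] clJs] : (U `&` diff_lift_at H f L) s /\ (closure J s -> J s \/ s = b).
  by case: J's => // /He.
by apply: F'L (diff_lift_at_act Hh Ls) => /clJs[//|/eqP]; apply/negP.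
Qed.

Definition partial_diff_lift H f (I : set R) (A : set (R * V)) := exists J F,
  [/\ is_interval J, open J, J `<=` I, forall s, J s -> diff_lift_at H f F s
    & A = [set (s, F s) | s in J]].

Definition graph_dom (A : set (R * V)) : set R := [set s | exists v, A (s, v)].

Lemma partial_diff_lift_dom H f I A : partial_diff_lift H f I A ->
  (forall s u v, A (s, u) -> A (s, v) -> u = v) /\
  exists G, [/\ is_interval (graph_dom A), open (graph_dom A), graph_dom A `<=` I,
    forall s, graph_dom A s -> diff_lift_at H f G s
    & forall s, graph_dom A s -> A (s, G s)].
Proof.
move=> [J [G [Jint Jopen JI G_lift ->]]]; split.
  by move=> s u v [? _ [-> <-]] [? _ [-> <-]].
suff JE : graph_dom [set (s, G s) | s in J] = J.
  by exists G; rewrite JE; split=> // s Js; exists s.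
by apply/seteqP; split=> [s [v [? Ju [<- _]]]|s Js] //; exists (G s), s.
Qed.

Lemma partial_diff_lift_bigcup H f I (C : set (set (R * V))) :
  C `<=` partial_diff_lift H f I -> total_on C subset ->
  partial_diff_lift H f I (\bigcup_(A in C) A).
Proof.
move=> /(_ _ _)/partial_diff_lift_dom C_lift chain.
pose W := \bigcup_(A in C) A; pose F s := xget 0 [set v | W (s, v)].
have F_eq A s v : C A -> A (s, v) -> F s = v.
  move=> CA Asv; apply: xget_unique; first by exists A.
  move=> u [B CB Bsu].
  have [E CE [/(_ _ Asv) Esv /(_ _ Bsu) Esu]] := total_on_directed chain CA CB.
  exact: (C_lift E CE).1 Esu Esv.
exists (graph_dom W), F; split.
- move=> x y [u [A CA Axu]] [v [B CB Byv]] z xyz.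
  have [E CE [/(_ _ Axu) Exu /(_ _ Byv) Eyv]] := total_on_directed chain CA CB.
  have [_ [G [Eint _ _ _ EG]]] := C_lift E CE.
  by exists (G z), E => //; apply/EG/(Eint x y) => //; [exists u | exists v].
- rewrite openE => s [v [A CA Asv]]; have [_ [G [_ Aopen _ _ _]]] := C_lift A CA.
  apply: filterS (open_nbhs_nbhs (conj Aopen (ex_intro _ v Asv))) => u [w Auw].
  by exists w, A.
- move=> s [v [A CA Asv]]; have [_ [G [_ _ AI _ _]]] := C_lift A CA.
  by apply: AI; exists v.
- move=> s [v [A CA Asv]]; have As : graph_dom A s by exists v.
  have [_ [G [_ Aopen _ /(_ s As) Gs GA]]] := C_lift A CA.
  apply: near_eq_diff_lift_at Gs.
  apply: filterS (open_nbhs_nbhs (conj Aopen As)) => u /GA Au.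
  by rewrite (F_eq A u (G u)).
- apply/seteqP; split=> [[s v] [A CA Asv]|[s v]].
    by exists s; [exists v, A | rewrite (F_eq A s v)].
  by move=> [u [w [A CA Auw]] [<- <-]]; exists A; rewrite ?(F_eq A u w).
Qed.

Lemma diff_lift_interval H f I : open I -> is_interval I ->
  (forall t, I t -> locally_diff_liftable H f t) ->
  exists F, forall t, I t -> diff_lift_at H f F t.
Proof.
move=> Iopen Iint loc.
have [A [[J [F [Jint Jopen JI F_lift AE]]] A_max]] :=
  Zorn_bigcup (@partial_diff_lift_bigcup H f I).
exists F; suff -> : I = J by [].
apply: contrapT => IJ.
have [b Ib [nJb clJb]] : exists2 b, I b & ~ J b /\ (J !=set0 -> closure J b).
  have [J_ex|J_empty] := pselect (J !=set0).
    have [|b Ib [nJb clJb]] := interval_missing_limit_point Iint Jopen JI J_ex.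
      exact/nesym.
    by exists b.
  have [t It] : I !=set0.
    apply: contrapT => /nonemptyPn I0; apply: IJ.
    by rewrite I0 ((nonemptyPn _).1 J_empty).
  by exists t => //; split=> [Jt|//]; apply: J_empty; exists t.
have Inear : \forall s \near b, I s by apply: open_nbhs_nbhs.
have [J' [F' [J'int J'open J'I [JJ' J'b] [F'F F'_lift]]]] :=
  diff_lift_extend Jint Jopen nJb clJb F_lift Inear (loc b Ib).
apply: (A_max [set (s, F' s) | s in J']); last first.
  by exists J', F'; split=> // s /J'I[/JI|].
rewrite AE; split=> [[_ _] [s Js [<- <-]]|/(_ (b, F' b))].
  by exists s; [exact: JJ'|rewrite F'F].
by case; [exists b | move=> s Js [sb _]; rewrite sb in Js].
Qed.

Lemma diff_lift_open H f U : open U ->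
  (forall t, U t -> locally_diff_liftable H f t) ->
  exists F, forall t, U t -> diff_lift_at H f F t.
Proof.
move=> Uopen loc.
have /choice[F F_lift] (A : set R) : exists F, forall t, A = connected_component U t ->
    forall s, A s -> diff_lift_at H f F s.
  have [[t ->]|none] := pselect (exists t, A = connected_component U t); last first.
    by exists f => t At; case: none; exists t.
  have [|||F F_lift] := @diff_lift_interval H f (connected_component U t); last by exists F.
  - exact: open_connected_component.
  - exact/connected_intervalP/component_connected.
  - by move=> s /connected_component_sub/loc.
exists (fun t => F (connected_component U t) t) => t Ut.
have t_refl := connected_component_refl Ut.
apply: near_eq_diff_lift_at (F_lift _ t erefl t t_refl).
have /open_nbhs_nbhs : open_nbhs t (connected_component U t).
  by split=> //; apply: open_connected_component.
by apply: filterS => s /same_connected_component ->.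
Qed.

Lemma diff_lift_half_neighborhood H f t w J (U : set R) : diff_mod H f t w ->
  is_interval J -> open J -> ~ J t -> open U -> U t ->
  (forall s, (U `&` J) s -> locally_diff_liftable H f s) ->
  exists2 F, forall s, (U `&` J) s -> diff_lift_at H f F s & has_jet J F t (f t) w.
Proof.
move=> fw Jint Jopen nJt Uopen Ut loc.
have [|F F_lift] := @diff_lift_open H f (U `&` J) _ loc; first exact: openI.
have [|h Hh Fjet] := lift_one_sided_jet Jint nJt fw (F := F).
  apply: filterS (open_nbhs_nbhs (conj Uopen Ut)) => s Us Js.
  have [Fs dF] := F_lift s (conj Us Js); split=> //.
  exact/differentiable_continuous/derivable1_diffP.
exists (act h^-1%g \o F) => [s /F_lift Fs|].
  by apply: diff_lift_at_act; rewrite ?groupV.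
by have := has_jet_act h^-1%g Fjet; rewrite !actK.
Qed.

Lemma locally_diff_liftable_punctured H f t w : diff_mod H f t w ->
  (\forall s \near t^', locally_diff_liftable H f s) -> locally_diff_liftable H f t.
Proof.
move=> fw; rewrite near_withinE => /nbhs_ballP[d /= d0 loc].
have loc_off J : ~ J t -> forall s, (ball t d `&` J) s -> locally_diff_liftable H f s.
  by move=> nJt s [ds Js]; apply: loc ds _; apply/eqP => st; rewrite st in Js.
have half J Jint Jopen nJt := diff_lift_half_neighborhood fw Jint Jopen nJt
  (ball_open t d) (ballxx t d0) (loc_off J nJt).
have [|||Fl Fl_lift Fl_jet] := half [set s | s < t].
- by move=> x y _ yt z /andP[_ zy]; apply: le_lt_trans zy yt.
- exact: open_lt.
- by rewrite /= ltxx.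
have [|||Fr Fr_lift Fr_jet] := half [set s | t < s].
- by move=> x y tx _ z /andP[xz _]; apply: lt_le_trans tx xz.
- exact: open_gt.
- by rewrite /= ltxx.
pose F s := if s < t then Fl s else if t < s then Fr s else f t.
have F_l s : s < t -> F s = Fl s by rewrite /F => ->.
have F_r s : t < s -> F s = Fr s by rewrite /F; case: ltgtP.
have Ft : F t = f t by rewrite /F ltxx.
exists F; near=> s; have ds : ball t d s by near: s; apply: nbhsx_ballx.
have [st|ts|->] := ltgtP s t.
- apply: near_eq_diff_lift_at (Fl_lift s (conj ds st)).
  by near do apply/esym/F_l; apply: lt_nbhsl.
- apply: near_eq_diff_lift_at (Fr_lift s (conj ds ts)).
  by near do apply/esym/F_r; apply: lt_nbhsr.
split; first by rewrite /lift_at Ft; apply: lift_at_refl.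
apply: (derivable_two_sided_jets (w := w)); rewrite Ft.
- by apply: eq_has_jet Fl_jet => u /= /F_l.
- by apply: eq_has_jet Fr_jet => u /= /F_r.
Unshelve. all: by end_near. Qed.

Definition lifting_property H := forall f I, open I ->
  (forall t, I t -> exists w, diff_mod H f t w) ->
  exists F, forall t, I t -> diff_lift_at H f F t.

Definition stabilizer H v := [set g in H | act g v == v].

Lemma group_set_stabilizer H v : group_set (stabilizer H v).
Proof.
apply/group_setP; split; first by rewrite inE group1 act1 eqxx.
move=> g h; rewrite !inE => /andP[Hg /eqP vg] /andP[Hh /eqP vh].
by rewrite groupM //= -actM vg vh.
Qed.

Canonical stabilizer_group H v := Group (group_set_stabilizer H v).

Lemma stabilizer_near H v : exists2 r : R, 0 < r & forall g x y, g \in H ->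
  `|x - v| <= r -> `|y - v| <= r -> `|act g x - y| <= r -> g \in stabilizer H v.
Proof.
have moved g : \forall r \near 0^'+, act g v != v -> 3 * r < `|act g v - v|.
  have [_|gv] := eqVneq (act g v) v; first by near=> r.
  near=> r => _; rewrite mulrC -ltr_pdivlMr //; near: r; apply: nbhs_right_lt.
  by rewrite divr_gt0 // normr_gt0 subr_eq0.
have [r [r0 Hr]] := filter_ex (filterI (nbhs_right_gt 0) (filter_forall _ moved)).
exists r => // g x y Hg xr yr xy; rewrite inE Hg /=; apply/negPn/negP => /Hr.
have := ler_distD (act g x) (act g v) v; have := ler_distD y (act g x) v.
by rewrite -linearB norm_act [`|v - x|]distrC; lra.
Unshelve. all: by end_near. Qed.

Lemma lift_near_base H f t w (r : R) : diff_mod H f t w -> 0 < r ->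
  exists2 F, forall s, lift_at H f F s & \forall s \near t, `|F s - f t| <= r.
Proof.
move=> fw r0; pose close s x := `|x - f t| <= r.
have [F HF] : {F : R -> V & forall s, lift_at H f F s /\
    ((exists2 g, g \in H & close s (act g (f s))) -> close s (F s))}.
  apply: (@choice _ _ (fun s x => (exists2 g, g \in H & x = act g (f s)) /\
    ((exists2 g, g \in H & close s (act g (f s))) -> close s x))) => s.
  have [[g Hg gs]|none] := pselect (exists2 g, g \in H & close s (act g (f s))).
    by exists (act g (f s)); split=> //; exists g.
  by exists (f s); split=> //; exists 1%g; rewrite ?act1.
exists F => [s|]; first exact: (HF s).1.
by apply: filterS (diff_mod_norm_le fw r0) => s; apply: (HF s).2.
Qed.

Lemma locally_diff_liftable_stabilizer H f t :
  lifting_property (stabilizer_group H (f t)) ->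
  (\forall s \near t, exists w, diff_mod H f s w) -> locally_diff_liftable H f t.
Proof.
move=> lift_stab fw; have [r r0 Hr] := stabilizer_near H (f t).
have [w Hw] := nbhs_singleton fw; have [F fF Ft] := lift_near_base Hw r0.
pose U := [set s | `|F s - f t| <= r /\ exists w, diff_mod H f s w]^°.
have Ut : U t by apply: filterI.
have [|s Us|L L_lift] := lift_stab F U; first exact: open_interior.
  have [Fs [ws fws]] := interior_subset Us.
  have [|w' Fw'] := diff_mod_lift (F := F) fws; first exact: filterE.
  exists w' => e e0; near=> u.
  have [g Hg gu] : exists2 g, g \in H & `|act g (F u) - F s - (u - s) *: w'| <= e * `|u - s|.
    by near: u; apply: Fw'.
  exists g => //; apply: (Hr g (F u) (F s)) => //.
    have : U u by near: u; apply: open_nbhs_nbhs; split=> //; apply: open_interior.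
    by case/interior_subset.
  by move: gu; apply: (near (near_remainder_norm_le s w' e r0) u).
exists L; have : nbhs t U by apply: open_nbhs_nbhs; split=> //; apply: open_interior.
apply: filterS => s /L_lift[[k]]; rewrite inE => /andP[Hk _] Ls dL; split=> //.
by apply: lift_at_trans (fF s) _; exists k.
Unshelve. all: by end_near. Qed.

Definition fixed_by H x := forall g, g \in H -> act g x = x.

(* At an accumulation point of parameters with [H]-fixed value, both the value
   and the derivative are [H]-fixed, so that every lift is differentiable. *)
Lemma lift_derivable_accumulation H f F t w : diff_mod H f t w ->
  (\forall s \near t, lift_at H f F s) -> ~ (\forall s \near t^', ~ fixed_by H (f s)) ->
  derivable F t 1.
Proof.
move=> fw fF acc.
have often (P : set R) : (\forall s \near t, P s) ->
    exists s, [/\ P s, s != t & fixed_by H (f s)].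
  move=> Pt; apply: contrapT => none; apply: acc; rewrite near_withinE.
  by apply: filterS Pt => s Ps st fs; apply: none; exists s.
have fix_v : fixed_by H (f t).
  move=> g Hg; apply/eqP; rewrite -subr_eq0 -normr_le0; apply/ler_addgt0Pr => e e0.
  have e20 : 0 < e / 2 by rewrite divr_gt0.
  have [s [[k Hk ks] _ fs]] := often _ (diff_mod_norm_le fw e20).
  have := ler_distD (f s) (act g (f t)) (f t); move: ks; rewrite fs //.
  by rewrite add0r -{2}(fs g Hg) -linearB norm_act [`|f t - f s|]distrC; lra.
have fix_w : fixed_by H w.
  move=> g Hg; apply/eqP; rewrite -subr_eq0 -normr_le0; apply/ler_addgt0Pr => e e0.
  have e20 : 0 < e / 2 by rewrite divr_gt0.
  have [s [[k Hk ks] st fs]] := often _ (fw _ e20); move: ks; rewrite fs //.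
  set x := f s - f t - _ => x_le; have st0 : 0 < `|s - t| by rewrite normr_gt0 subr_eq0.
  have xg : x - act g x = (s - t) *: (act g w - w).
    have -> : act g x = f s - f t - (s - t) *: act g w.
      by rewrite /x linearB linearB linearZ /= fs // fix_v.
    by rewrite /x opprB addrC addrA subrK scalerBr.
  rewrite -(ler_pM2l st0) -normrZ -xg; apply: le_trans (ler_normB _ _) _.
  by rewrite norm_act add0r; lra.
have Ft : F t = f t by have [g Hg ->] := nbhs_singleton fF; rewrite fix_v.
apply/derivable_has_jet; exists w => e e0.
apply: filterS2 fF (lift_near_line F fw e0) => s Fs /(_ Fs)[h Hh] + _.
by rewrite act_line fix_v // fix_w // Ft opprD addrA.
Qed.

Theorem diff_lift_exists H : lifting_property H.
Proof.
have [n leHn] := ubnP #|H|; elim: n => // n IHn in H leHn * => f I Iopen fI.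
pose U := [set t | I t /\ \forall s \near t^', ~ fixed_by H (f s)].
have Inear t : I t -> \forall s \near t, I s by move=> It; apply: open_nbhs_nbhs.
have Uopen : open U.
  rewrite openE => t [It /dnbhs_near_dnbhs nfix].
  by apply: filterS2 nfix (Inear t It) => s.
have loc_nonfixed s : I s -> ~ fixed_by H (f s) -> locally_diff_liftable H f s.
  move=> Is nfix; apply: locally_diff_liftable_stabilizer; last first.
    by apply: filterS (Inear s Is) => u /fI.
  apply: IHn; rewrite -ltnS; apply: leq_trans leHn; rewrite ltnS.
  apply/proper_card/properP; split.
    by apply/fintype.subsetP => g; rewrite inE => /andP[].
  move/existsNP: nfix => [g /not_implyP[Hg gs]]; exists g => //.
  by rewrite inE Hg; apply/eqP.
have [t Ut|F F_lift] := diff_lift_open (H := H) (f := f) Uopen.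
  have [w fw] := fI t Ut.1; apply: (locally_diff_liftable_punctured fw).
  move: Ut.2; rewrite !near_withinE; apply: filterS2 (Inear t Ut.1) => s Is nfix st.
  exact: loc_nonfixed (nfix st).
pose F' t := if pselect (U t) then F t else f t.
have F'_lift t : lift_at H f F' t.
  rewrite /lift_at /F'; case: pselect => Ut; [exact: (F_lift t Ut).1 | exact: lift_at_refl].
exists F' => t It; have [Ut|nUt] := pselect (U t).
  apply: near_eq_diff_lift_at (F_lift t Ut).
  have : nbhs t U by apply: open_nbhs_nbhs.
  by apply: filterS => s Us; rewrite /F'; case: pselect.
split=> //; have [w fw] := fI t It.
apply: (lift_derivable_accumulation fw); first exact: filterE.
by move=> nfix; apply: nUt.
Unshelve. all: by end_near. Qed.

End Lifting.

(** * Invariants of finite linear groups *)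

Local Notation "''Y_' i" := (mpoly.mpolyX _ (mpoly.mnm1 i))
  (at level 8, i at level 2).
Local Notation homog d := (mpoly.ishomog1 d (@mpoly.mdeg _)).
Local Notation ev p x := (mpoly.meval (fun_of_matrix x 0) p).

Section Reynolds.

Variables (F : fieldType) (A : comAlgType F) (gT : finGroupType) (H : {group gT}).
Variable act : gT -> {lrmorphism A -> A}.
Hypothesis act1 : forall p, act 1%g p = p.
Hypothesis actM : forall g h p, g \in H -> h \in H -> act g (act h p) = act (g * h)%g p.

Implicit Types p q : A.

Definition act_invariant p := forall g, g \in H -> act g p = p.

Lemma orbit_prod_invariant p : act_invariant (\prod_(g in H) act g p).
Proof.
move=> h Hh; rewrite rmorph_prod [RHS](reindex_inj (mulgI h)) /=.
by apply: eq_big => [g|g Hg]; rewrite ?groupMl // actM.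
Qed.

Definition reynolds p : A := #|H|%:R^-1 *: \sum_(g in H) act g p.

Lemma reynolds_invariant p : act_invariant (reynolds p).
Proof.
move=> h Hh; rewrite linearZ raddf_sum [in RHS]/reynolds; congr (_ *: _).
rewrite [RHS](reindex_inj (mulgI h)) /=.
by apply: eq_big => [g|g Hg]; rewrite ?groupMl // actM.
Qed.

Lemma reynolds_id p : #|H|%:R != 0 :> F -> act_invariant p -> reynolds p = p.
Proof.
move=> H_neq0 pH; rewrite /reynolds (eq_bigr (fun=> p)) => [|g Hg]; last exact: pH.
by rewrite sumr_const -scaler_nat scalerA mulVf // scale1r.
Qed.

Lemma reynolds_mull p q : act_invariant p -> reynolds (p * q) = p * reynolds q.
Proof.
move=> pH; rewrite /reynolds -scalerAr mulr_sumr; congr (_ *: _).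
by apply: eq_bigr => g Hg; rewrite rmorphM /= pH.
Qed.

Lemma reynolds_is_linear : linear reynolds.
Proof.
move=> c p q; rewrite /reynolds scalerA mulrC -scalerA -scalerDr; congr (_ *: _).
by rewrite scaler_sumr -big_split; apply: eq_bigr => g _; rewrite linearP.
Qed.

HB.instance Definition _ := GRing.isLinear.Build F A A _ reynolds reynolds_is_linear.

Definition orbit_poly p : {poly A} := \prod_(g <- enum H) ('X - (act g p)%:P).

Lemma coef_orbit_poly_invariant p j : act_invariant (orbit_poly p)`_j.
Proof.
move=> h Hh; suff E : map_poly (act h) (orbit_poly p) = orbit_poly p by rewrite -coef_map E.
rewrite /orbit_poly !big_enum /= rmorph_prod [RHS](reindex_inj (mulgI h)) /=.
apply: eq_big => [g|g Hg]; first by rewrite groupMl.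
by rewrite rmorphB /= map_polyX map_polyC /= actM.
Qed.

Lemma orbit_poly_relation p : p ^+ #|H| = - \sum_(j < #|H|) (orbit_poly p)`_j * p ^+ j.
Proof.
have sz : size (orbit_poly p) = #|H|.+1 by rewrite size_prod_XsubC -cardE.
have : (orbit_poly p).[p] = 0.
  rewrite /orbit_poly big_enum /= (bigD1 1%g) //= hornerM hornerXsubC.
  by rewrite act1 subrr mul0r.
have : orbit_poly p \is monic by apply: monic_prod_XsubC.
rewrite horner_coef sz big_ord_recr /= monicE lead_coefE sz /= => /eqP ->.
by rewrite mul1r addrC => /eqP; rewrite addr_eq0 => /eqP.
Qed.

End Reynolds.

Section NoetherGenerators.

Variables (F : fieldType) (N : nat) (gT : finGroupType) (H : {group gT}).
Variable act : gT -> {lrmorphism mpoly.mpoly N F -> mpoly.mpoly N F}.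
Hypothesis act1 : forall p, act 1%g p = p.
Hypothesis actM : forall g h p, g \in H -> h \in H -> act g (act h p) = act (g * h)%g p.
Hypothesis act_homog : forall g d p, p \is homog d -> act g p \is homog d.

Implicit Types (p q : mpoly.mpoly N F) (m : mpoly.multinom N).

Lemma reynolds_homog p d : p \is homog d -> reynolds H act p \is homog d.
Proof. by move=> Hp; apply/rpredZ/rpred_sum => g _; apply: act_homog. Qed.

Lemma coef_orbit_poly_homog p j :
  p \is homog 1 -> (orbit_poly H act p)`_j \is homog (#|H| - j)%N.
Proof.
move=> p_homog; rewrite /orbit_poly cardE.
elim: (enum H) j => [|g r IHr] j.
  by rewrite big_nil coef1; case: j => [|j]; [exact: mpoly.dhomog1 | exact: rpred0].
rewrite big_cons mulrBl coefB coefXM coefCM; apply: rpredB.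
  by case: j => [|j] /=; [exact: rpred0 | rewrite subSS].
have [jr|rj] := leqP j (size r).
  by rewrite /= subSn // -add1n; apply: mpoly.dhomogM => //; apply: act_homog.
by rewrite [_`_j]nth_default ?mulr0 ?rpred0 // size_prod_XsubC.
Qed.

(* [orbit_poly_relation] lowers an exponent [m i >= #|H|], so every averaged
   monomial is a combination of those of degree at most [N * #|H|]. *)
Lemma reynolds_monomial_subalg (S : subalgClosed (mpoly.mpoly N F)) :
  (forall i j, (j < #|H|)%N -> (orbit_poly H act 'Y_i)`_j \in S) ->
  (forall m, (mpoly.mdeg m <= N * #|H|)%N -> reynolds H act (mpoly.mpolyX F m) \in S) ->
  forall m, reynolds H act (mpoly.mpolyX F m) \in S.
Proof.
move=> S_orbit S_small m; have [n] := ubnP (mpoly.mdeg m).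
elim: n m => // n IHn m; rewrite ltnS => mn.
have [/S_small//|mdeg_gt] := leqP (mpoly.mdeg m) (N * #|H|)%N.
have [i Hi] : exists i, (#|H| <= m i)%N.
  apply/existsP; apply: contraLR mdeg_gt; rewrite -leqNgt => /existsPn small.
  rewrite mpoly.mdegE -[N in leqRHS]card_ord -sum_nat_const; apply: leq_sum => i _.
  by rewrite ltnW // ltnNge.
pose low := mpoly.mnm_sub m (mpoly.mnm_muln (mpoly.mnm1 i) #|H|).
have m_split : m = mpoly.mnm_add (mpoly.mnm_muln (mpoly.mnm1 i) #|H|) low.
  rewrite mpoly.addmC mpoly.submK //; apply/mpoly.mnm_lepP => j.
  by rewrite mpoly.mulmnE mpoly.mnm1E; case: eqP => [<-|]; rewrite ?mul1n ?mul0n.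
rewrite m_split mpoly.mpolyXD -mpoly.mpolyXn (orbit_poly_relation H act1).
rewrite mulNr mulr_suml raddfN raddf_sum /= -scaleN1r.
apply/rpredZ/rpred_sum => j _.
rewrite -mulrA reynolds_mull; last exact: coef_orbit_poly_invariant.
apply: rpredM; first exact: S_orbit.
rewrite mpoly.mpolyXn -mpoly.mpolyXD; apply/IHn/leq_trans/mn.
by rewrite [in leqRHS]m_split !mpoly.mdegD !mpoly.mdegMn mpoly.mdeg1 !mul1n ltn_add2r.
Qed.

Lemma invariants_sub_subalg (S : subalgClosed (mpoly.mpoly N F)) : #|H|%:R != 0 :> F ->
  (forall i j, (j < #|H|)%N -> (orbit_poly H act 'Y_i)`_j \in S) ->
  (forall m, (mpoly.mdeg m <= N * #|H|)%N -> reynolds H act (mpoly.mpolyX F m) \in S) ->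
  forall p, act_invariant H act p -> p \in S.
Proof.
move=> H_neq0 S_orbit S_small p /(reynolds_id H_neq0) <-.
rewrite [p]mpoly.mpolyE raddf_sum; apply: rpred_sum => m _.
by rewrite /= linearZ; apply/rpredZ/reynolds_monomial_subalg.
Qed.

End NoetherGenerators.

Lemma mpoly_lrmorphism_ext (K : comNzRingType) (N : nat) (A : comAlgType K)
  (f g : {lrmorphism mpoly.mpoly N K -> A}) : (forall i, f 'Y_i = g 'Y_i) -> f =1 g.
Proof.
move=> fg p; rewrite [p]mpoly.mpolyE !raddf_sum; apply: eq_bigr => m _.
rewrite /= !linearZ; congr (_ *: _); rewrite /= mpoly.mpolyXE_id !rmorph_prod.
by apply: eq_bigr => i _; rewrite !rmorphXn /= fg.
Qed.

Section PolynomialAction.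

Variables (R : realType) (N : nat).
Implicit Types (A B : 'M[R[i]]_N) (p q : cpoly R N) (x : 'rV[R[i]]_N).

HB.instance Definition _ A := GRing.LRMorphism.copy (@poly_act R N A)
  (mpoly.comp_mpoly [tuple \sum_(i < N) A i j *: mpoly.mpolyX R[i] (mpoly.mnm1 i) | j < N]).

Lemma polymapE k (s : 'I_k -> cpoly R N) x j : polymap s x 0 j = ev (s j) x.
Proof. by rewrite mxE. Qed.

Lemma ev_subst k (s : 'I_k -> cpoly R N) (q : cpoly R k) x :
  ev (subst s q) x = ev q (polymap s x).
Proof.
rewrite /subst mpoly.comp_mpoly_meval; apply: mpoly.meval_eq => j.
by rewrite tnth_mktuple polymapE.
Qed.

Lemma poly_actX A j : poly_act A 'Y_j = \sum_(i < N) A i j *: 'Y_i.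
Proof. by rewrite /poly_act mpoly.comp_mpolyXU -tnth_nth tnth_mktuple. Qed.

Lemma ev_poly_act A p x : ev (poly_act A p) x = ev p (x *m A).
Proof.
rewrite /poly_act mpoly.comp_mpoly_meval; apply: mpoly.meval_eq => j.
rewrite tnth_mktuple mxE raddf_sum /=; apply: eq_bigr => i _.
by rewrite mpoly.mevalZ mpoly.mevalXU mulrC.
Qed.

Lemma poly_actM A B p : poly_act A (poly_act B p) = poly_act (A *m B) p.
Proof.
rewrite -[LHS]/((poly_act A \o poly_act B) p); apply: mpoly_lrmorphism_ext => j /=.
rewrite !poly_actX raddf_sum; under eq_bigr do rewrite /= linearZ /= poly_actX scaler_sumr.
rewrite exchange_big /=; apply: eq_bigr => i _.
by rewrite mxE scaler_suml; apply: eq_bigr => l _; rewrite scalerA mulrC.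
Qed.

Lemma poly_act1 p : poly_act 1%:M p = p.
Proof.
rewrite -[RHS]/(idfun p); apply: mpoly_lrmorphism_ext => j.
rewrite /= poly_actX (bigD1 j) //= big1 ?addr0 => [|i ij]; first by rewrite mxE eqxx scale1r.
by rewrite mxE (negbTE ij) scale0r.
Qed.

Lemma homog_prod (I : Type) (r : seq I) (F : I -> cpoly R N) (d : I -> nat) :
  (forall i, F i \is homog (d i)) -> \prod_(i <- r) F i \is homog (\sum_(i <- r) d i)%N.
Proof.
move=> HF; elim/big_rec2: _ => [|i e q _ Hq]; first exact: mpoly.dhomog1.
exact: mpoly.dhomogM.
Qed.

Lemma poly_act_homog A p d : p \is homog d -> poly_act A p \is homog d.
Proof.
move=> /mpoly.dhomogP Hp; rewrite [p]mpoly.mpolyE raddf_sum big_seq.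
apply: rpred_sum => m /Hp /= <-; rewrite linearZ; apply: rpredZ.
rewrite mpoly.mdegE mpoly.mpolyXE_id rmorph_prod; apply: homog_prod => i /=.
rewrite rmorphXn /= poly_actX; set q := \sum_l _.
suff q_homog : q \is homog 1 by have := mpoly.dhomogMn (m i) q_homog; rewrite mul1n.
by apply: rpred_sum => l _; apply: rpredZ; rewrite mpoly.dhomogX /= mpoly.mdeg1.
Qed.

Lemma ev_homog p d (c : R[i]) x : p \is homog d -> ev p (c *: x) = c ^+ d * ev p x.
Proof.
move=> /mpoly.dhomogP Hp; rewrite !mpoly.mevalE mulr_sumr !big_seq.
apply: eq_bigr => m mp; rewrite mulrCA; congr (_ * _).
under eq_bigr do rewrite mxE exprMn.
by rewrite big_split /= -expr_sum -mpoly.mdegE (Hp m mp).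
Qed.

Lemma is_homogeneous_pdeg p : is_homogeneous p -> p \is homog (pdeg p).
Proof. by move=> [d /mpoly.dhomog_msize]. Qed.

Lemma ev_pdeg p c x : is_homogeneous p -> ev p (c *: x) = c ^+ pdeg p * ev p x.
Proof. by move=> /is_homogeneous_pdeg/ev_homog. Qed.

End PolynomialAction.

Section GeneratedSubalgebra.

Variables (R : realType) (N m : nat) (s : 'I_m -> cpoly R N).

Definition generated : {pred cpoly R N} := fun p => `[< exists q, p = subst s q >].

Lemma generatedP p : reflect (exists q, p = subst s q) (p \in generated).
Proof. exact: asboolP. Qed.

Lemma generated_subalg_closed : GRing.subalg_closed generated.
Proof.
split=> [|c p q /generatedP[u ->] /generatedP[v ->]|p q /generatedP[u ->] /generatedP[v ->]].
- by apply/generatedP; exists 1; rewrite /subst rmorph1.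
- by apply/generatedP; exists (c *: u + v); rewrite /subst linearP.
- by apply/generatedP; exists (u * v); rewrite /subst rmorphM.
Qed.

HB.instance Definition _ := GRing.isSubalgClosed.Build R[i] (cpoly R N) generated
  (GRing.subalg_closed_semi generated_subalg_closed).

Lemma generated_gen j : s j \in generated.
Proof.
by apply/generatedP; exists 'Y_j; rewrite /subst mpoly.comp_mpolyXU -tnth_nth tnth_mktuple.
Qed.

Lemma subst_generated k (u : 'I_k -> cpoly R N) q :
  (forall j, u j \in generated) -> subst u q \in generated.
Proof.
move=> gu; rewrite /subst mpoly.comp_mpolyEX; apply: rpred_sum => a _; apply: rpredZ.
rewrite mpoly.comp_mpolyX; apply: rpred_prod => j _.
by apply: rpredX; rewrite tnth_mktuple.
Qed.

End GeneratedSubalgebra.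

Section Noether.

Variables (R : realType) (gT : finGroupType) (G : {group gT}) (N : nat).
Variables (rho : mx_representation R[i] G N) (H : {group gT}).
Hypothesis sHG : H \subset G.

Implicit Types (p q : cpoly R N) (g h : gT).

Definition rep_act g : {lrmorphism cpoly R N -> cpoly R N} := poly_act (rho g).

Lemma rep_act1 p : rep_act 1%g p = p.
Proof. by rewrite /rep_act /= repr_mx1 poly_act1. Qed.

Lemma rep_actM g h p : g \in H -> h \in H -> rep_act g (rep_act h p) = rep_act (g * h)%g p.
Proof.
by move=> Hg Hh; rewrite /rep_act /= poly_actM repr_mxM ?(fintype.subsetP sHG).
Qed.

Lemma rep_act_homog g d p : p \is homog d -> rep_act g p \is homog d.
Proof. exact: poly_act_homog. Qed.

Lemma act_invariantP p : act_invariant H rep_act p <-> Defs.invariant rho H p.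
Proof. by []. Qed.

Lemma invariant_orbit_prod p : Defs.invariant rho H (\prod_(g in H) rep_act g p).
Proof. exact: (act_invariantP _).1 (orbit_prod_invariant rep_actM p). Qed.

Lemma invariant_reynolds p : Defs.invariant rho H (reynolds H rep_act p).
Proof. exact: (act_invariantP _).1 (reynolds_invariant rep_actM p). Qed.

Lemma invariant_coef_orbit_poly p j : Defs.invariant rho H (orbit_poly H rep_act p)`_j.
Proof. exact: (act_invariantP _).1 (coef_orbit_poly_invariant rep_actM p j). Qed.

Definition hom_gen m (s : 'I_m -> cpoly R N) :=
  [/\ forall j, is_homogeneous (s j), forall j, Defs.invariant rho H (s j)
    & forall p, Defs.invariant rho H p -> p \in generated s].

Lemma noether_finiteness : exists m (s : 'I_m -> cpoly R N), hom_gen s.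
Proof.
pose idx : finType := ('I_N * 'I_#|H| + mpoly.bmultinom N (N * #|H|).+1)%type.
pose gen (a : idx) : cpoly R N := match a with
  | inl ij => (orbit_poly H rep_act 'Y_ij.1)`_ij.2
  | inr m => reynolds H rep_act (mpoly.mpolyX _ (mpoly.bmnm m))
  end.
have homogX (i : 'I_N) : ('Y_i : cpoly R N) \is homog 1.
  by rewrite mpoly.dhomogX /= mpoly.mdeg1.
pose s (j : 'I_#|{: idx}|) := gen (enum_val j); exists _, s; split=> [j|j|].
- rewrite /s; case: (enum_val j) => [[i k]|m] /=.
    exists (#|H| - k)%N; exact: (coef_orbit_poly_homog H rep_act_homog).
  exists (mpoly.mdeg (mpoly.bmnm m)).
  by apply: (reynolds_homog H rep_act_homog); rewrite mpoly.dhomogX.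
- rewrite /s; case: (enum_val j) => [[i k]|m] /=.
    exact: invariant_coef_orbit_poly.
  exact: invariant_reynolds.
have s_gen a : gen a \in generated s by rewrite -(enum_rankK a); apply: generated_gen.
apply: (invariants_sub_subalg rep_act1 rep_actM).
- by rewrite pnatr_eq0 -lt0n cardG_gt0.
- by move=> i j jH; apply: (s_gen (inl (i, Ordinal jH))).
- by move=> m; rewrite -ltnS => Hm; apply: (s_gen (inr (mpoly.BMultinom Hm))).
Qed.

Lemma min_hom_gen_exists : exists m (s : 'I_m -> cpoly R N), min_hom_gen rho H s.
Proof.
have ex : exists m, `[< exists s, @hom_gen m s >].
  by have [m [s Hs]] := noether_finiteness; exists m; apply/asboolP; exists s.
case: (ex_minnP ex) => m /asboolP[s [s_hom s_inv s_gen]] m_min.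
exists m, s; split=> // [p /s_gen/generatedP//|j [q Hq]].
case: m s s_hom s_inv s_gen m_min j q Hq => [|m] s s_hom s_inv s_gen m_min j q Hq.
  by case: j Hq.
suff /m_min : `[< exists s, @hom_gen m s >] by rewrite ltnn.
pose s' a := s (lift j a); apply/asboolP; exists s'.
have gen_other a : a != j -> s a \in generated s'.
  by rewrite eq_sym => /unlift_some[b -> _]; apply: (generated_gen s').
split=> [a|a|p /s_gen/generatedP[u ->]]; [exact: s_hom | exact: s_inv |].
apply: subst_generated => a; have [->|] := eqVneq a j; last exact: gen_other.
rewrite Hq; apply: subst_generated => b; case: ifPn => [_|]; last exact: gen_other.
exact: rpred0.
Qed.

End Noether.

(** * Topology of complex row vectors *)

Section ComplexModulus.

Variable R : realType.
Implicit Types (z w : R[i]) (r : R).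

Lemma cabs_normc z : cabs z = Normc.normc z.
Proof. by case: z. Qed.

Lemma cabsE z : (cabs z)%:C%C = `|z|.
Proof. by case: z. Qed.

Lemma cabs_ge0 z : 0 <= cabs z.
Proof. exact: sqrtr_ge0. Qed.

Lemma cabsD z w : cabs (z + w) <= cabs z + cabs w.
Proof. by rewrite !cabs_normc; apply: le_normcD. Qed.

Lemma cabsN z : cabs (- z) = cabs z.
Proof. by rewrite !cabs_normc; apply: normcN. Qed.

Lemma cabsR r : cabs (r%:C)%C = `|r|.
Proof. by rewrite /cabs /= expr0n addr0 sqrtr_sqr. Qed.

Lemma ler_Re_cabs z : `|complex.Re z| <= cabs z.
Proof. by rewrite -sqrtr_sqr ler_sqrt ?lerDl ?sqr_ge0 // addr_ge0 ?sqr_ge0. Qed.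

Lemma ler_Im_cabs z : `|complex.Im z| <= cabs z.
Proof. by rewrite -sqrtr_sqr ler_sqrt ?lerDr ?sqr_ge0 // addr_ge0 ?sqr_ge0. Qed.

Lemma cabs_ReIm z : cabs z <= `|complex.Re z| + `|complex.Im z|.
Proof.
case: z => x y; rewrite /cabs /= -[leRHS]ger0_norm ?addr_ge0 // -sqrtr_sqr.
rewrite ler_sqrt ?sqr_ge0 // sqrrD !real_normK ?num_real //.
by rewrite -addrA lerD2l lerDr mulrn_wge0 // mulr_ge0.
Qed.

End ComplexModulus.

HB.instance Definition _ (R : realType) := NormedModule.copy R[i] (R[i])^o.

Section ComplexTopology.

Variable R : realType.
Implicit Types (z : R[i]).

Lemma gt0_complex_real z : 0 < z -> exists2 r : R, 0 < r & z = r%:C%C.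
Proof.
by case: z => x y; rewrite ltcE /= => /andP[/eqP -> x0]; exists x.
Qed.

Lemma cvg_cabsP {T : Type} {F : set_system T} {FF : Filter F} (f : T -> R[i]) z :
  f @ F --> z <-> forall e : R, 0 < e -> \forall x \near F, cabs (f x - z) < e.
Proof.
split=> [/cvgrPdist_lt fz e e0|fz].
  have := fz (e%:C)%C; rewrite ltcR => /(_ e0); apply: filterS => x.
  by rewrite -cabsE ltcR -cabsN opprB.
apply/cvgrPdist_lt => _ /gt0_complex_real[e e0 ->]; apply: filterS (fz _ e0) => x.
by rewrite -cabsE ltcR -cabsN opprB.
Qed.

Lemma cvg_complexP {T : Type} {F : set_system T} {FF : Filter F} (f : T -> R[i]) z :
  f @ F --> z <-> (fun x => complex.Re (f x)) @ F --> complex.Re z /\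
                  (fun x => complex.Im (f x)) @ F --> complex.Im z.
Proof.
split=> [/cvg_cabsP fz|[/cvgrPdist_lt fRe /cvgrPdist_lt fIm]].
  split; apply/cvgrPdist_lt => e /fz; apply: filterS => x; rewrite distrC.
    by apply: le_lt_trans; rewrite -raddfB; apply: ler_Re_cabs.
  by apply: le_lt_trans; rewrite -raddfB; apply: ler_Im_cabs.
apply/cvg_cabsP => e e0; have e20 : 0 < e / 2 by rewrite divr_gt0.
apply: filterS2 (fRe _ e20) (fIm _ e20) => x xRe xIm.
by apply: le_lt_trans (cabs_ReIm _) _; rewrite !raddfB /= !(distrC (_ (f x))); lra.
Qed.

Lemma compact_complex_square (r : R) :
  compact [set z : R[i] | `|complex.Re z| <= r /\ `|complex.Im z| <= r].
Proof.
pose mk (p : R * R) : R[i] := complex.Complex p.1 p.2.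
have mk_cont : continuous mk.
  by move=> p; apply/cvg_complexP; split; [exact: cvg_fst|exact: cvg_snd].
have square_compact : compact (`[- r, r] `*` `[- r, r]).
  by apply: compact_setX; apply: segment_compact.
have := continuous_compact (continuous_subspaceT mk_cont) square_compact.
congr compact; apply/seteqP; split=> [_ [[x y] /= [xr yr] <-]|[x y] /= [xr yr]].
  by rewrite !in_itv /= -!ler_norml in xr yr.
by exists (x, y) => //=; rewrite !in_itv /= -!ler_norml.
Qed.

End ComplexTopology.

Section ComplexRowVectors.

Variables (R : realType) (k : nat).
Implicit Types (x y z : 'rV[R[i]]_k).

Lemma nbhs_vclose x (P : set 'rV[R[i]]_k) :
  nbhs x P <-> exists2 e : R, 0 < e & forall y, vclose e y x -> P y.
Proof.
split=> [/nbhs_ballP[_ /gt0_complex_real[e e0 ->] eP]|[e e0 eP]].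
  exists e => // y yx; apply: eP; split=> [|i j]; first by rewrite ltcR.
  by rewrite ord1 /ball /= -cabsE ltcR -cabsN opprB.
apply/nbhs_ballP; exists (e%:C)%C; first by rewrite /= ltcR.
move=> y [_ yx]; apply: eP => j; have := yx 0 j.
by rewrite /ball /= -cabsE ltcR -cabsN opprB.
Qed.

Lemma vopenP (S : set 'rV[R[i]]_k) : vopen S <-> open S.
Proof. by rewrite openE; split=> So x Sx; apply/nbhs_vclose; apply: So. Qed.

Lemma continuous_rV (T : topologicalType) (f : T -> 'rV[R[i]]_k) (t : T) :
  (forall j, f u 0 j @[u --> t] --> f t 0 j) -> f u @[u --> t] --> f t.
Proof.
move=> ft P /nbhs_vclose[e e0 eP].
have : \forall u \near t, forall j, cabs (f u 0 j - f t 0 j) < e.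
  by apply: filter_forall => j; move/cvg_cabsP: (ft j); apply.
by apply: filterS => u fu; apply: eP.
Qed.

Lemma near_translate x y (P : set 'rV[R[i]]_k) :
  nbhs (x + y) P -> \forall z \near y, P (x + z).
Proof. exact: (cvgD (F := nbhs y) (cvg_cst x) cvg_id). Qed.

End ComplexRowVectors.

Section PolynomialContinuity.

Variables (R : realType) (k : nat).

Lemma continuous_ev (p : cpoly R k) : continuous (fun x : 'rV[R[i]]_k => ev p x).
Proof.
rewrite (_ : (fun x : 'rV[R[i]]_k => ev p x) = (fun x => \sum_(m <- mpoly.msupp p)
    mpoly.mcoeff m p * \prod_j \prod_(l < m j) x 0 j)); last first.
  apply/funext => x; rewrite mpoly.mevalE; apply: eq_bigr => m _; congr (_ * _).
  by apply: eq_bigr => j _; rewrite prodr_const card_ord.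
apply: continuous_big => [|m _ x]; first exact: add_continuous.
apply: (cvgM (F := nbhs x)); first exact: cvg_cst.
apply: cvg_big => [|j _]; first exact: mul_continuous.
apply: cvg_big => [|l _]; first exact: mul_continuous.
exact: coord_continuous.
Qed.

Lemma continuous_polymap m (s : 'I_m -> cpoly R k) : continuous (polymap s).
Proof.
move=> x; apply: continuous_rV => j; rewrite polymapE.
by under eq_cvg do rewrite polymapE; apply: continuous_ev.
Qed.

Lemma polymap_near m (s : 'I_m -> cpoly R k) (x : 'rV[R[i]]_k) (e : R) : 0 < e ->
  \forall y \near x, vclose e (polymap s y) (polymap s x).
Proof.
move=> e0; apply: (@continuous_polymap m s x (fun z => vclose e z (polymap s x))).
by apply/nbhs_vclose; exists e.
Qed.

Lemma compact_box (r : R) : compact [set x : 'rV[R[i]]_k |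
  forall j, `|complex.Re (x 0 j)| <= r /\ `|complex.Im (x 0 j)| <= r].
Proof.
have := @rV_compact R[i] k _ (fun=> @compact_complex_square R r).
by congr compact; apply/seteqP; split=> x Hx j; apply: Hx.
Qed.

End PolynomialContinuity.

(** * The orbit space of a finite linear group *)

Lemma nat_nonroot (K : numDomainType) (p : {poly K}) : p != 0 -> exists n : nat, ~~ root p n%:R.
Proof.
move=> p0; apply: contrapT => all_roots.
suff : (size p < size p)%N by rewrite ltnn.
rewrite -{1}(size_iota 0 (size p)) -(size_map (fun n => n%:R : K)).
apply: max_poly_roots => //; last first.
  by rewrite map_inj_uniq ?iota_uniq //; apply: mulrIn (oner_neq0 _).
by apply/allP => _ /mapP[n _ ->]; apply: contraT => nroot; case: all_roots; exists n.
Qed.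

Lemma monic_root_norm_le (K : numDomainType) (k : nat) (c : 'I_k -> K) (z : K) :
  z ^+ k = - \sum_(j < k) c j * z ^+ j -> `|z| <= 1 + \sum_(j < k) `|c j|.
Proof.
case: k c => [|k] c zk; first by move/eqP: zk; rewrite expr0 big_ord0 oppr0 oner_eq0.
have c_ge0 : 0 <= \sum_(j < k.+1) `|c j| by apply: sumr_ge0.
have [z1|z1] := real_leP (normr_real z) (@real1 K).
  by rewrite (le_trans z1) // lerDl.
have z_gt0 : 0 < `|z| ^+ k by rewrite exprn_gt0 // (lt_trans ltr01).
apply: le_trans (_ : \sum_(j < k.+1) `|c j| <= _); last by rewrite lerDr.
rewrite -(ler_pM2r z_gt0) -exprS -[leLHS]normrX zk normrN mulr_suml.
apply: le_trans (ler_norm_sum _ _ _) _; apply: ler_sum => j _.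
rewrite normrM normrX ler_wpM2l // ler_weXn2l ?(ltW z1) //.
by rewrite -ltnS.
Qed.

Lemma continuous_mulmxr (R : realType) k l (A : 'M[R[i]]_(k, l)) :
  continuous (fun x : 'rV[R[i]]_k => x *m A).
Proof.
have mulE (x : 'rV[R[i]]_k) j : (x *m A) 0 j = \sum_i x 0 i * A i j by rewrite mxE.
move=> x; apply: continuous_rV => j; rewrite mulE; under eq_cvg do rewrite mulE.
apply: (cvg_big add_continuous (F := nbhs x)) => i _.
apply: (cvgM (F := nbhs x)); last exact: cvg_cst.
exact: coord_continuous.
Qed.

Section OrbitSpace.

Variables (R : realType) (gT : finGroupType) (G : {group gT}) (N : nat).
Variables (rho : mx_representation R[i] G N) (H : {group gT}).
Hypothesis sHG : H \subset G.

Implicit Types (x y : 'rV[R[i]]_N).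

Variables (m : nat) (tau : 'I_m -> cpoly R N).
Hypothesis tau_inv : forall j, Defs.invariant rho H (tau j).
Hypothesis tau_gen : forall p, Defs.invariant rho H p -> p \in generated tau.

Lemma polymap_act x g : g \in H -> polymap tau (x *m rho g) = polymap tau x.
Proof. by move=> Hg; apply/rowP => j; rewrite !polymapE -ev_poly_act tau_inv. Qed.

Lemma ev_invariant_eq p x y :
  Defs.invariant rho H p -> polymap tau y = polymap tau x -> ev p y = ev p x.
Proof. by move=> /tau_gen/generatedP[q ->] yx; rewrite !ev_subst yx. Qed.

Definition linear_form (t : R[i]) : cpoly R N := \sum_(i < N) t ^+ i *: 'Y_i.

Lemma ev_linear_form t x : ev (linear_form t) x = (rVpoly x).[t].
Proof.
rewrite raddf_sum horner_poly; apply: eq_bigr => i _.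
by rewrite /= mpoly.mevalZ mpoly.mevalXU mulrC valK.
Qed.

(* If [y] is not in the orbit of [x], some linear form [l] satisfies
   [l (x - y g) != 0] for all [g]; the product of the translates of [l x - l]
   is then an invariant that vanishes at [x] but not at [y]. *)
Lemma polymap_separates x y : polymap tau y = polymap tau x ->
  exists2 g, g \in H & y *m rho g = x.
Proof.
move=> yx; apply: contrapT => no_g.
pose q g := rVpoly (x - y *m rho g).
have q_neq0 g : g \in H -> q g != 0.
  move=> Hg; apply: contra_notN no_g => /eqP q0; exists g => //; apply/esym/eqP.
  by rewrite -subr_eq0 -[_ - _]rVpolyK -/(q g) q0 raddf0.
have [n] : exists n : nat, ~~ root (\prod_(g in H) q g) n%:R.
  by apply: nat_nonroot; apply/prodf_neq0 => g; apply: q_neq0.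
rewrite /root horner_prod => /eqP; apply.
pose p := \prod_(g in H) rep_act rho g
  (mpoly.mpolyC N (ev (linear_form n%:R) x) - linear_form n%:R).
have ev_p (z : 'rV[R[i]]_N) : ev p z = \prod_(g in H) ev (linear_form n%:R) (x - z *m rho g).
  rewrite rmorph_prod; apply: eq_bigr => g _.
  by rewrite /= ev_poly_act mpoly.mevalB mpoly.mevalC !ev_linear_form raddfB hornerD hornerN.
have <- : ev p x = 0.
  by rewrite ev_p (bigD1 1%g) //= repr_mx1 mulmx1 subrr ev_linear_form raddf0 horner0 mul0r.
rewrite -(ev_invariant_eq _ yx); last exact: invariant_orbit_prod.
by rewrite ev_p; apply: eq_bigr => g _; rewrite ev_linear_form.
Qed.

Definition box (B : R) := [set x : 'rV[R[i]]_N |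
  forall j, `|complex.Re (x 0 j)| <= B /\ `|complex.Im (x 0 j)| <= B].

(* Each coordinate is a root of its orbit polynomial, whose coefficients are
   polynomials in [tau]. *)
Lemma polymap_locally_bounded (z : 'rV[R[i]]_m) :
  exists B, \forall u \near z, forall y, polymap tau y = u -> box B y.
Proof.
have /choice[q qE] (ij : 'I_N * 'I_#|H|) : exists q : cpoly R m, forall y,
    ev ((orbit_poly H (rep_act rho) 'Y_ij.1)`_ij.2) y = ev q (polymap tau y).
  have /tau_gen/generatedP[q qE] := invariant_coef_orbit_poly rho sHG 'Y_ij.1 ij.2.
  by exists q => y; rewrite qE ev_subst.
pose B := 1 + \sum_i \sum_j (1 + cabs (ev (q (i, j)) z)); exists B.
have : \forall u \near z, forall ij, cabs (ev (q ij) u) <= 1 + cabs (ev (q ij) z).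
  apply: (@filter_forall _ _ (fun ij u => cabs (ev (q ij) u) <= _) (nbhs z)) => ij.
  have /cvg_cabsP/(_ 1 ltr01) := @continuous_ev _ _ (q ij) z.
  apply: filterS => u qu; have := cabsD (ev (q ij) u - ev (q ij) z) (ev (q ij) z).
  by rewrite subrK; lra.
apply: filterS => u Hu y yu i.
suff yB : cabs (y 0 i) <= B.
  by split; apply: le_trans yB; [apply: ler_Re_cabs | apply: ler_Im_cabs].
have := orbit_poly_relation H (rep_act1 rho) 'Y_i.
move/(congr1 (fun p => ev p y)); rewrite rmorphXn rmorphN rmorph_sum /= mpoly.mevalXU.
under eq_bigr => j _ do rewrite rmorphM rmorphXn /= mpoly.mevalXU (qE (i, j)) yu.
move/monic_root_norm_le; under eq_bigr do rewrite -cabsE.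
rewrite -cabsE -rmorph_sum -(rmorph1 (real_complex R)) -rmorphD lecR => /le_trans; apply.
rewrite lerD2l (bigD1 i) //= ler_wpDr //; last by apply: ler_sum => j _; apply: Hu.
apply: sumr_ge0 => i' _; apply: sumr_ge0 => j _.
by rewrite addr_ge0 // cabs_ge0.
Qed.

Lemma closed_range_polymap : closed (range (polymap tau)).
Proof.
move=> z clz; have [B HB] := polymap_locally_bounded z.
have img_closed : closed (polymap tau @` box B).
  apply: compact_closed; first exact: norm_hausdorff.
  apply: continuous_compact; last exact: compact_box.
  exact/continuous_subspaceT/continuous_polymap.
have : closure (polymap tau @` box B) z.
  move=> P zP; have [u [[y _ yu] [Pu /(_ y yu) By]]] := clz _ (filterI zP HB).
  by exists u; split=> //; exists y.
by move/img_closed => [y _ <-]; exists y.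
Qed.

Lemma polymap_near_lift x (P : set 'rV[R[i]]_N) : nbhs x P ->
  \forall u \near polymap tau x, forall y, polymap tau y = u ->
    exists2 g, g \in H & P (y *m rho g).
Proof.
move=> xP; have [B HB] := polymap_locally_bounded (polymap tau x).
pose near_orbit := \bigcup_(g in [set` H]) (mulmx^~ (rho g) @^-1` P^°).
have far_closed : closed (~` near_orbit).
  apply/open_closedC/bigcup_open => g _; apply: open_comp; last exact: open_interior.
  by move=> y _; apply: continuous_mulmxr.
have img_closed : closed (polymap tau @` (box B `&` ~` near_orbit)).
  apply: compact_closed; first exact: norm_hausdorff.
  apply: continuous_compact; first exact/continuous_subspaceT/continuous_polymap.
  by apply: compact_closedI => //; apply: compact_box.
have nimg : (~` (polymap tau @` (box B `&` ~` near_orbit))) (polymap tau x).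
  move=> [y [_ far_y] /polymap_separates[g Hg yg]]; apply: far_y.
  by exists g; [exact: Hg | rewrite /preimage /mkset yg; exact: xP].
have := open_nbhs_nbhs (conj (closed_openC img_closed) nimg).
apply: filterS2 HB => u Hu nu y yu; apply: contrapT => none; apply: nu.
exists y => //; split; first exact: Hu.
by move=> [g Hg /interior_subset Py]; apply: none; exists g.
Qed.

End OrbitSpace.

(** * The invariant norm and the underlying real space *)

Section InvariantNorm.

Variables (R : realType) (gT : finGroupType) (G : {group gT}) (N : nat).
Variable rho : mx_representation R[i] G N.

Implicit Types (x y : 'rV[R[i]]_N) (g : gT).

Definition inorm x : R := complex.Re (\sum_(g in G) `|x *m rho g|).

Lemma inormE x : (inorm x)%:C%C = \sum_(g in G) `|x *m rho g|.
Proof. by rewrite RRe_real // ger0_real // sumr_ge0. Qed.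

Lemma inorm_act x g : g \in G -> inorm (x *m rho g) = inorm x.
Proof.
move=> Gg; congr complex.Re; rewrite [RHS](reindex_inj (mulgI g)) /=.
by apply: eq_big => h; rewrite ?groupMl // => Gh; rewrite -mulmxA -repr_mxM.
Qed.

Lemma inormD x y : inorm (x + y) <= inorm x + inorm y.
Proof.
rewrite -lecR rmorphD /= !inormE -big_split /=; apply: ler_sum => g _.
by rewrite mulmxDl ler_normD.
Qed.

Lemma inormZ (z : R[i]) x : inorm (z *: x) = cabs z * inorm x.
Proof.
apply: (@complexI R); rewrite rmorphM /= cabsE !inormE mulr_sumr.
by apply: eq_bigr => g _; rewrite -scalemxAl normrZ.
Qed.

Lemma inorm0 : inorm 0 = 0.
Proof. by rewrite -(scale0r 0) inormZ (cabsR 0) normr0 mul0r. Qed.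

Lemma inormN x : inorm (- x) = inorm x.
Proof. by rewrite -scaleN1r inormZ cabsN (cabsR 1) normr1 mul1r. Qed.

Lemma norm_le_inorm x : `|x| <= (inorm x)%:C%C.
Proof.
by rewrite inormE (bigD1 1%g) //= repr_mx1 mulmx1 lerDl sumr_ge0.
Qed.

Lemma inorm0_eq0 x : inorm x = 0 -> x = 0.
Proof. by move=> x0; apply/eqP; rewrite -normr_le0 (le_trans (norm_le_inorm x)) // x0. Qed.

Lemma inorm_gt0 x : x != 0 -> 0 < inorm x.
Proof.
move=> x0; rewrite -ltcR; apply: lt_le_trans (norm_le_inorm x).
by rewrite normr_gt0.
Qed.

Lemma nbhs_inorm x (P : set 'rV[R[i]]_N) :
  nbhs x P <-> exists2 e : R, 0 < e & forall y, inorm (x - y) < e -> P y.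
Proof.
split=> [/nbhs_normP[_ /gt0_complex_real[e e0 ->] eP]|[e e0 eP]].
  exists e => // y xy; apply: eP.
  by apply: le_lt_trans (norm_le_inorm _) _; rewrite ltcR.
have inorm_cvg : (inorm (x - y))%:C%C @[y --> x] --> (inorm (x - x))%:C%C.
  rewrite inormE; under eq_cvg do rewrite inormE.
  apply: (cvg_big add_continuous (F := nbhs x)) => g _; apply: (cvg_norm (F := nbhs x)).
  rewrite mulmxBl; under eq_cvg do rewrite mulmxBl.
  by apply: (cvgB (F := nbhs x)); [exact: cvg_cst | exact: continuous_mulmxr].
have /cvg_cabsP/(_ e e0) := inorm_cvg; apply: filterS => y.
rewrite [x - x]subrr inorm0 rmorph0 subr0 cabsR => /(le_lt_trans (ler_norm _)).
exact: eP.
Qed.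

End InvariantNorm.

Section Realified.

Variables (R : realType) (gT : finGroupType) (G : {group gT}) (N : nat).
Variable rho : mx_representation R[i] G N.

(* An alias of the representation space, to carry its real structure and the
   invariant norm. *)
Definition realified (rho : mx_representation R[i] G N) : Type := 'rV[R[i]]_N.

HB.instance Definition _ := GRing.Zmodule.on (realified rho).

Definition realified_scale (r : R) (x : realified rho) : realified rho :=
  (r%:C)%C *: (x : 'rV[R[i]]_N).

Lemma realified_scaleA r s x :
  realified_scale r (realified_scale s x) = realified_scale (r * s) x.
Proof. by rewrite /realified_scale scalerA rmorphM. Qed.

Lemma realified_scale1 : left_id 1 realified_scale.
Proof. by move=> x; rewrite /realified_scale rmorph1 scale1r. Qed.

Lemma realified_scaleDr : right_distributive realified_scale +%R.
Proof. by move=> r x y; apply: scalerDr. Qed.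

Lemma realified_scaleDl x : {morph realified_scale^~ x : r s / r + s}.
Proof. by move=> r s; rewrite /realified_scale rmorphD; apply: scalerDl. Qed.

HB.instance Definition _ := GRing.Zmodule_isLmodule.Build R (realified rho)
  realified_scaleA realified_scale1 realified_scaleDr realified_scaleDl.

Lemma realified_scaleE (r : R) (x : realified rho) :
  r *: x = (r%:C)%C *: (x : 'rV[R[i]]_N) :> 'rV[R[i]]_N.
Proof. by []. Qed.

Lemma inorm_realified_scale (r : R) (x : realified rho) :
  inorm rho (r *: x) = `|r| * inorm rho x.
Proof. by rewrite realified_scaleE inormZ cabsR. Qed.

HB.instance Definition _ := Lmodule_isNormed.Build R (realified rho)
  (inormD rho) inorm_realified_scale (@inorm0_eq0 _ _ _ _ rho).

Lemma realified_normE (x : realified rho) : `|x| = inorm rho x.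
Proof. by []. Qed.

Lemma nbhs_realified (x : realified rho) (P : set (realified rho)) :
  nbhs x P <-> nbhs (x : 'rV[R[i]]_N) (P : set 'rV[R[i]]_N).
Proof. exact: iff_trans (nbhs_normP x P) (iff_sym (nbhs_inorm rho x P)). Qed.

End Realified.

Lemma continuous_difference_quotient (R : realType) (V : normedModType R) (f : R -> V) (t : R) :
  derivable f t 1 -> exists q : R -> V, (forall s, f s = f t + (s - t) *: q s) /\
    forall s, {for s, continuous f} -> {for s, continuous q}.
Proof.
move=> /derivable_has_jet[w fw].
pose q s := if s == t then w else (s - t)^-1 *: (f s - f t).
have fE s : f s = f t + (s - t) *: q s.
  rewrite /q; case: eqVneq => [->|st]; first by rewrite subrr scale0r addr0.
  by rewrite scalerA divff ?subr_eq0 // scale1r addrC subrK.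
exists q; split=> // s fs; have [->|st] := eqVneq s t.
  have qt : q t = w by rewrite /q eqxx.
  apply/cvgrPdist_le => e e0; apply: filterS (fw e e0) => u /(_ I).
  have [->|ut] := eqVneq u t; first by move=> _; rewrite subrr normr0 ltW.
  rewrite (fE u) [f t + _]addrC addrK -qt -scalerBr normrZ mulrC distrC.
  by rewrite ler_pM2r // normr_gt0 subr_eq0.
have qE u : u != t -> (u - t)^-1 *: (f u - f t) = q u by rewrite /q => /negbTE ->.
suff : (u - t)^-1 *: (f u - f t) @[u --> s] --> q s.
  apply: cvg_trans; apply: near_eq_cvg.
  have : \forall u \near s, u != t by apply: open_nbhs_nbhs; split; [exact: open_neq|].
  exact: filterS.
rewrite -qE //; apply: cvgZ; last by apply: cvgB => //; apply: cvg_cst.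
apply: cvgV; first by rewrite subr_eq0.
by apply: cvgB; [apply: cvg_id | apply: cvg_cst].
Qed.

Lemma derivable_scalel (R : realType) (V : normedModType R) (f : R -> R) (t : R) (v : V) :
  derivable f t 1 -> derivable (fun s => f s *: v) t 1.
Proof. by move=> /derivable1_diffP ft; apply/derivable1_diffP/differentiableZl. Qed.

Section RealifiedAction.

Variables (R : realType) (gT : finGroupType) (G : {group gT}) (N : nat).
Variable rho : mx_representation R[i] G N.

Implicit Types (x : realified rho) (g h : [subg G]).

Definition realified_mul g x : realified rho := x *m rho (sgval g).

Lemma realified_mul_linear g : linear (realified_mul g).
Proof. by move=> r x y; rewrite /realified_mul mulmxDl -scalemxAl. Qed.

HB.instance Definition _ g := GRing.isLinear.Build R (realified rho) (realified rho) _
  (realified_mul g) (realified_mul_linear g).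

Definition realified_act g : {linear realified rho -> realified rho} := realified_mul g.

Lemma realified_act1 x : realified_act 1%g x = x.
Proof. by rewrite /= /realified_mul repr_mx1 mulmx1. Qed.

Lemma realified_actM g h x : realified_act h (realified_act g x) = realified_act (g * h)%g x.
Proof. by rewrite /= /realified_mul -mulmxA -repr_mxM ?subgP. Qed.

Lemma norm_realified_act g x : `|realified_act g x| = `|x|.
Proof. by apply: inorm_act; apply: subgP. Qed.

End RealifiedAction.

Section RealifiedCurves.

Variables (R : realType) (gT : finGroupType) (G : {group gT}) (N : nat).
Variable rho : mx_representation R[i] G N.

Implicit Types (c : R -> realified rho) (I : set R) (t : R) (x : realified rho) (j : 'I_N).

Definition re_coord j x : R := complex.Re ((x : 'rV[R[i]]_N) 0 j).
Definition im_coord j x : R := complex.Im ((x : 'rV[R[i]]_N) 0 j).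

Lemma re_coord_linear j : linear (re_coord j).
Proof.
move=> r x y; rewrite /re_coord !mxE; case: (x 0 j) => a b; case: (y 0 j) => c d.
by rewrite /= mul0r subr0.
Qed.

Lemma im_coord_linear j : linear (im_coord j).
Proof.
move=> r x y; rewrite /im_coord !mxE; case: (x 0 j) => a b; case: (y 0 j) => c d.
by rewrite /= mul0r addr0.
Qed.

HB.instance Definition _ j := GRing.isLinear.Build R (realified rho) R _
  (re_coord j) (re_coord_linear j).
HB.instance Definition _ j := GRing.isLinear.Build R (realified rho) R _
  (im_coord j) (im_coord_linear j).

Lemma cvg_realified (T : Type) (F : set_system T) (f : T -> realified rho) (x : realified rho) :
  f @ F --> x <-> (f : T -> 'rV[R[i]]_N) @ F --> (x : 'rV[R[i]]_N).
Proof. by split=> fx P /nbhs_realified/fx. Qed.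

Lemma continuous_re_im_coord j : continuous (re_coord j) /\ continuous (im_coord j).
Proof.
suff coord_cvg x : re_coord j @ x --> re_coord j x /\ im_coord j @ x --> im_coord j x.
  by split=> x; have [] := coord_cvg x.
apply/(cvg_complexP (F := nbhs x)) => P xP.
exact/nbhs_realified/(@coord_continuous _ _ _ 0 j).
Qed.

Definition realified_component j x : realified rho :=
  re_coord j x *: (delta_mx 0 j : realified rho)
  + im_coord j x *: ('i%C *: delta_mx 0 j : realified rho).

Lemma sum_realified_component x : \sum_j realified_component j x = x.
Proof.
rewrite [RHS]row_sum_delta; apply: eq_bigr => j _.
transitivity (((re_coord j x)%:C%C + (im_coord j x)%:C%C * 'i%C) *: delta_mx 0 j : 'rV[R[i]]_N).
  by rewrite scalerDl -scalerA.
by rewrite mulrC -complexE.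
Qed.

Lemma curve_diffP I c :
  curve_diff I (c : R -> 'rV[R[i]]_N) <-> forall t, I t -> derivable c t 1.
Proof.
split=> [cI t It|cI j t /cI/derivable1_diffP ct]; last first.
  have [re_cont im_cont] := continuous_re_im_coord j.
  split; apply/derivable1_diffP.
    exact: (differentiable_comp ct (linear_differentiable (f := re_coord j) _ re_cont)).
  exact: (differentiable_comp ct (linear_differentiable (f := im_coord j) _ im_cont)).
have -> : c = \sum_j (fun s => realified_component j (c s)).
  by apply/funext => s; rewrite fct_sumE sum_realified_component.
apply: (derivable_sum (h := fun j s => realified_component j (c s))) => j.
have [re_der im_der] := cI j t It.
exact: derivableD (derivable_scalel re_der) (derivable_scalel im_der).
Qed.

End RealifiedCurves.

(** * Slices *)

Section Slice.

Variables (R : realType) (gT : finGroupType) (G : {group gT}) (N : nat).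
Variable rho : mx_representation R[i] G N.

Lemma isotropy_group_set v : group_set (isotropy rho v).
Proof.
apply/group_setP; split; first by rewrite inE group1 repr_mx1 mulmx1 eqxx.
move=> g h; rewrite !inE => /andP[Gg /eqP vg] /andP[Gh /eqP vh].
by rewrite groupM //= repr_mxM // mulmxA vg vh.
Qed.

Canonical isotropy_group v := Group (isotropy_group_set v).

Lemma isotropy_sub v : isotropy rho v \subset G.
Proof. by apply/fintype.subsetP => g; rewrite inE => /andP[]. Qed.

Lemma isotropy_act v x g : g \in isotropy rho v -> (v + x) *m rho g = v + x *m rho g.
Proof. by rewrite inE mulmxDl => /andP[_ /eqP ->]. Qed.

Variable v : 'rV[R[i]]_N.

Lemma slice_radius_exists : exists2 r : R, 0 < r &
  forall g, g \in G -> v *m rho g != v -> 2 * r <= inorm rho (v *m rho g - v).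
Proof.
suff : \forall r \near (0:R)^'+, forall g, g \in G -> v *m rho g != v ->
    2 * r <= inorm rho (v *m rho g - v).
  by move=> Hr; near (0:R)^'+ => r; exists r => //; near: r.
apply: filter_forall => g; have [vg|vg] := eqVneq (v *m rho g) v; first exact: filterE.
have dist_gt0 : 0 < inorm rho (v *m rho g - v) / 2.
  by rewrite divr_gt0 // inorm_gt0 // subr_eq0.
apply: filterS (nbhs_right_le dist_gt0) => r Hr _ _; lra.
Unshelve. all: by end_near. Qed.

Variable r : R.
Hypothesis r0 : 0 < r.
Hypothesis r_sep : forall g, g \in G -> v *m rho g != v -> 2 * r <= inorm rho (v *m rho g - v).

Lemma slice_transporter x y g : inorm rho x < r -> inorm rho y < r -> g \in G ->
  (v + x) *m rho g = v + y -> g \in isotropy rho v /\ x *m rho g = y.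
Proof.
move=> xr yr Gg xgy; suff vg : v *m rho g = v.
  by rewrite inE Gg vg eqxx; split=> //; move: xgy; rewrite mulmxDl vg => /addrI.
apply/eqP; apply: contraT => /(r_sep Gg).
have -> : v *m rho g - v = y + - (x *m rho g).
  by rewrite -[v *m rho g](addrK (x *m rho g)) -mulmxDl xgy addrAC [v + y]addrC addrK.
by have := inormD rho y (- (x *m rho g)); rewrite inormN inorm_act //; lra.
Qed.

Variables (n : nat) (sigma : 'I_n -> cpoly R N).
Hypothesis sigma_inv : forall j, Defs.invariant rho G (sigma j).
Hypothesis sigma_gen : forall p, Defs.invariant rho G p -> p \in generated sigma.
Variables (m : nat) (tau : 'I_m -> cpoly R N).
Hypothesis tau_inv : forall j, Defs.invariant rho (isotropy rho v) (tau j).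
Hypothesis tau_gen : forall p, Defs.invariant rho (isotropy rho v) p -> p \in generated tau.

Let K := isotropy_group v.
Let sKG : K \subset G := isotropy_sub v.

Lemma slice_polymap_eq x y : inorm rho x < r -> inorm rho y < r ->
  polymap tau x = polymap tau y <-> polymap sigma (v + x) = polymap sigma (v + y).
Proof.
move=> xr yr; split=> [/(polymap_separates (H := K) sKG tau_gen)[g Kg <-]|].
  by rewrite -isotropy_act // (polymap_act sigma_inv) // (fintype.subsetP sKG).
move=> /(polymap_separates (H := G) (subxx _) sigma_gen)[g Gg xgy].
have [Kg <-] := slice_transporter xr yr Gg xgy.
by rewrite (polymap_act (H := K) tau_inv).
Qed.

Lemma nbhs_slice x : inorm rho x < r -> \forall y \near (x : 'rV[R[i]]_N), inorm rho y < r.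
Proof.
move=> xr; apply/(nbhs_inorm rho); exists (r - inorm rho x); first by rewrite subr_gt0.
move=> y xy; have := inormD rho x (- (x - y)); rewrite inormN opprB addrC subrK; lra.
Qed.

Lemma near_slice_lift x (P : set 'rV[R[i]]_N) : inorm rho x < r -> nbhs x P ->
  \forall z \near polymap sigma (v + x), forall y, polymap sigma y = z ->
    exists2 x', inorm rho x' < r /\ P x' & exists2 g, g \in G & y *m rho g = v + x'.
Proof.
move=> xr xP; have : \forall y \near v + x, inorm rho (- v + y) < r /\ P (- v + y).
  apply: (@near_translate _ _ (- v) (v + x) (fun y => inorm rho y < r /\ P y)).
  by rewrite addKr; apply: filterI (nbhs_slice xr) xP.
move/(polymap_near_lift (H := G) (subxx _) sigma_gen); apply: filterS => z Hz y /Hz[g Gg Qy].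
by exists (- v + y *m rho g) => //; exists g => //; rewrite addNKr.
Qed.

Lemma slice_open_image : exists O : set 'rV[R[i]]_n, vopen O /\
  forall z, (exists2 x, inorm rho x < r & polymap sigma (v + x) = z) <->
            (O z /\ exists w, polymap sigma w = z).
Proof.
pose covered z := forall w, polymap sigma w = z ->
  exists2 x, inorm rho x < r & polymap sigma (v + x) = z.
exists covered°; split; first by apply/vopenP; apply: open_interior.
move=> z; split=> [[x xr <-]|[/interior_subset Cz [w /Cz]] //].
split; last by exists (v + x).
suff : \forall z \near polymap sigma (v + x), covered z by [].
apply: filterS (near_slice_lift xr (P := setT) filterT) => u Hu w wu.
have [y [yr _] [g Gg wg]] := Hu w wu; exists y => //.
by rewrite -wg (polymap_act sigma_inv).
Qed.

Lemma slice_continuous x (e : R) : 0 < e -> exists2 d : R, 0 < d &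
  forall y, vclose d (polymap tau y) (polymap tau x) ->
    vclose e (polymap sigma (v + y)) (polymap sigma (v + x)).
Proof.
move=> e0; have : nbhs x (fun y => vclose e (polymap sigma (v + y)) (polymap sigma (v + x))).
  apply: (@near_translate _ _ v x (fun y => vclose e (polymap sigma y) (polymap sigma (v + x)))).
  exact: polymap_near.
move/(polymap_near_lift (H := K) sKG tau_gen)/nbhs_vclose => [d d0 Hd].
exists d => // y /Hd/(_ y erefl)[g Kg].
by rewrite -isotropy_act // (polymap_act sigma_inv) // (fintype.subsetP sKG).
Qed.

Lemma slice_inverse_continuous x (e : R) : inorm rho x < r -> 0 < e ->
  exists2 d : R, 0 < d & forall y, inorm rho y < r ->
    vclose d (polymap sigma (v + y)) (polymap sigma (v + x)) ->
    vclose e (polymap tau y) (polymap tau x).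
Proof.
move=> xr e0; have : nbhs x (fun y => vclose e (polymap tau y) (polymap tau x)).
  exact: polymap_near.
move/(near_slice_lift xr)/nbhs_vclose => [d d0 Hd].
exists d => // y yr /Hd/(_ (v + y) erefl)[x' [x'r x'_close] [g Gg gE]].
have [Kg x'E] := slice_transporter yr x'r Gg gE.
by rewrite -(polymap_act (H := K) tau_inv y Kg) x'E.
Qed.

Lemma luna_slice_ball : luna_slice rho sigma v tau [set x | inorm rho x < r].
Proof.
split; first by apply/vopenP; rewrite openE => x /nbhs_slice.
- by rewrite /= inorm0.
- by move=> g /(fintype.subsetP sKG) Gg x; rewrite /= inorm_act.
- exact: slice_polymap_eq.
split; [exact: slice_open_image | |].
  by move=> x _ e e0; have [d d0 Hd] := slice_continuous x e0; exists d => // y _; apply: Hd.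
by move=> x xr e e0; have [d d0 Hd] := slice_inverse_continuous xr e0; exists d.
Qed.

End Slice.

(** * One-flat curves *)

Lemma min_hom_gen_generated (R : realType) (gT : finGroupType) (G : {group gT}) N
    (rho : mx_representation R[i] G N) (H : {set gT}) m (s : 'I_m -> cpoly R N) :
  min_hom_gen rho H s -> forall p, Defs.invariant rho H p -> p \in generated s.
Proof. by move=> [_ _ s_gen _] p /s_gen p_gen; apply/generatedP. Qed.

Section OneFlatCurves.

Variables (R : realType) (gT : finGroupType) (G : {group gT}) (N : nat).
Variables (rho : mx_representation R[i] G N) (n : nat) (sigma : 'I_n -> cpoly R N).
Hypothesis sigma_min : min_hom_gen rho G sigma.

Implicit Types (I : set R) (c : R -> 'rV[R[i]]_n) (f : R -> realified rho) (t : R).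

Let sigma_inv : forall j, Defs.invariant rho G (sigma j).
Proof. by have [] := sigma_min. Qed.

Let sigma_gen := min_hom_gen_generated sigma_min.

Lemma diff_lift_one_flat I c f t : (forall s, I s -> derivable f s 1) ->
  (forall s, I s -> polymap sigma (f s) = c s) -> I t -> one_flat_at rho sigma I c t.
Proof.
move=> f_diff f_lift It v vt m tau tau_min; have [tau_hom tau_inv _ _] := tau_min.
have [g Gg fg] : exists2 g, g \in G & f t *m rho g = v.
  by apply: (polymap_separates (subxx _) sigma_gen); rewrite f_lift.
have [r r0 r_sep] := slice_radius_exists rho v.
have tau_gen := min_hom_gen_generated tau_min.
exists [set x | inorm rho x < r]; split; first exact: luna_slice_ball.
have f_cont s : I s -> {for s, continuous f}.
  by move=> /f_diff/derivable1_diffP/differentiable_continuous.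
have [q [fE q_cont]] := continuous_difference_quotient (f_diff t It).
have fgE s : f s *m rho g = v + (s - t)%:C%C *: (q s *m rho g).
  by rewrite fE mulmxDl fg -scalemxAl.
have /nbhs_ballP[d d0 small] : \forall s \near t, inorm rho ((s - t)%:C%C *: (q s *m rho g)) < r.
  have /cvgrPdist_lt/(_ r r0) := f_cont t It; apply: filterS => s.
  rewrite distrC realified_normE -(inorm_act rho _ Gg).
  by rewrite [(_ - _) *m _]mulmxBl fgE fg addrC addKr.
exists d => //; exists (fun j s => ev (tau j) (q s *m rho g)); split=> [j s Is _|s Is st].
  have q_cvg : q @ s --> (q s : 'rV[R[i]]_N) by apply/cvg_realified/q_cont/f_cont.
  apply/cvg_complexP => P /continuous_ev/continuous_mulmxr; exact: q_cvg.
exists ((s - t)%:C%C *: (q s *m rho g)); first by apply: small; rewrite /ball /= distrC.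
split; first by rewrite -fgE (polymap_act sigma_inv) // f_lift.
by apply/rowP => j; rewrite polymapE mxE ev_pdeg.
Qed.

Lemma one_flat_direction I c (v : 'rV[R[i]]_N) t : open I -> I t ->
  polymap sigma v = c t -> one_flat_at rho sigma I c t ->
  exists w : 'rV[R[i]]_N, forall P, nbhs w P ->
    \forall s \near t^', exists2 y, P y & polymap sigma (v + (s - t)%:C%C *: y) = c s.
Proof.
move=> Iopen It vt flat; pose K := isotropy_group rho v.
have sKG : K \subset G := isotropy_sub rho v.
have [m [tau tau_min]] := min_hom_gen_exists rho sKG.
have [tau_hom _ _ _] := tau_min; have tau_gen := min_hom_gen_generated tau_min.
have [S [_ [d d0 [a [a_cont aP]]]]] := flat v vt m tau tau_min.
pose A s : 'rV[R[i]]_m := \row_j a j s.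
have A_cvg : A @ t^' --> A t.
  apply: cvg_within_filter; apply: continuous_rV => j.
  rewrite mxE; under eq_cvg do rewrite mxE.
  by apply/cvg_complexP/a_cont; rewrite ?subrr ?normr0.
have quotient : \forall s \near t^', exists2 y, polymap tau y = A s &
    polymap sigma (v + (s - t)%:C%C *: y) = c s.
  rewrite near_withinE; apply: filterS2 (open_nbhs_nbhs (conj Iopen It)) (nbhsx_ballx t d d0).
  move=> s Is; rewrite /ball /= distrC => sd st; have [x _ [sx tx]] := aP s Is sd.
  have st0 : (s - t)%:C%C != 0 :> R[i] by rewrite fmorph_eq0 subr_eq0.
  exists ((s - t)%:C%C^-1 *: x); last by rewrite scalerA divff // scale1r.
  apply/rowP => j; rewrite polymapE ev_pdeg // -polymapE tx !mxE mulrA.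
  by rewrite -exprMn mulVf // expr1n mul1r.
have [w _ tw] : range (polymap tau) (A t).
  have range_closed := closed_range_polymap (H := K) sKG tau_gen.
  apply: (@closed_cvg _ _ t^' _ A _ range_closed _ (A t) A_cvg).
  by apply: filterS quotient => s [y <- _]; exists y.
exists w => P wP; rewrite -tw in A_cvg.
have := A_cvg _ (polymap_near_lift (H := K) sKG tau_gen wP).
apply: filterS2 quotient => s [y ty sy] /(_ y ty)[g Kg Py]; exists (y *m rho g) => //.
by rewrite scalemxAl -isotropy_act // (polymap_act sigma_inv) // (fintype.subsetP sKG).
Qed.

Lemma one_flat_diff_mod I c f t : open I -> I t ->
  (forall s, I s -> polymap sigma (f s) = c s) -> one_flat_at rho sigma I c t ->
  exists w, diff_mod (@realified_act _ _ _ _ rho) [set: [subg G]]%G f t w.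
Proof.
move=> Iopen It f_lift flat.
have [w Hw] := one_flat_direction Iopen It (f_lift t It) flat; exists w => e e0.
have : nbhs w (fun y => inorm rho (w - y) < e) by apply/(nbhs_inorm rho); exists e.
move=> /Hw; rewrite near_withinE; apply: filterS2 (open_nbhs_nbhs (conj Iopen It)) => s Is Hs.
have [->|/Hs[y wy]] := eqVneq s t.
  by exists 1%g; rewrite ?inE // realified_act1 !subrr scale0r subrr !normr0 mulr0.
rewrite -f_lift // => /esym/(polymap_separates (subxx _) sigma_gen)[g Gg fg].
exists (subg G g); first by rewrite inE.
have -> : realified_act rho (subg G g) (f s) = f t + (s - t) *: (y : realified rho).
  by rewrite /= /realified_mul subgK.
rewrite [f t + _]addrC addrK -scalerBr normrZ mulrC distrC.
by apply: ler_wpM2r (ltW wy); apply: normr_ge0.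
Qed.

End OneFlatCurves.

Theorem theorem6p4 (R : realType) (gT : finGroupType) (G : {group gT})
  (N : nat) (rho : mx_representation R[i] G N)
  (n : nat) (sigma : 'I_n -> cpoly R N) (hsigma : min_hom_gen rho G sigma)
  (D : nat) (hD : is_D rho D)
  (a b : \bar R) (c : R -> 'rV[R[i]]_n)
  (hcV : forall t, oitv a b t -> exists x, polymap sigma x = c t)
  (hcD : curve_Ck (oitv a b) D c) :
  (exists cbar : R -> 'rV[R[i]]_N,
     curve_diff (oitv a b) cbar /\
     forall t, oitv a b t -> polymap sigma (cbar t) = c t)
  <-> (forall t, oitv a b t -> one_flat_at rho sigma (oitv a b) c t).
Proof.
split=> [[cbar [/(curve_diffP (rho := rho)) cbar_diff cbar_lift]] t It|flat].
  exact: (diff_lift_one_flat hsigma cbar_diff cbar_lift It).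
have /choice[f f_lift] t : exists x, oitv a b t -> polymap sigma x = c t.
  have [/hcV[x xt]|nIt] := pselect (oitv a b t); first by exists x.
  by exists 0 => /nIt.
have Iopen : open (oitv a b) by apply: openI; [exact: open_ereal_gt | exact: open_ereal_lt].
have [_ sigma_inv _ _] := hsigma.
have f_diff_mod t It := one_flat_diff_mod hsigma Iopen It f_lift (flat t It).
have [F F_lift] := diff_lift_exists (@realified_act1 _ _ _ _ rho) (@realified_actM _ _ _ _ rho)
  (@norm_realified_act _ _ _ _ rho) Iopen f_diff_mod.
exists F; split=> [|t It].
  by apply/(curve_diffP (rho := rho)) => t /F_lift[].
have [[g _ ->] _] := F_lift t It.
by rewrite /= (polymap_act sigma_inv) ?subgP // f_lift.
Qed.
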